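(* Let $n\ge2$, let $\Omega\subset\mathbb{R}^n$ be a bounded convex domain, and let $0\le\alpha<2$, $p>0$, and $M>0$. Let $u\in C(\overline\Omega)$ be a nonzero convex solution to $$\mu_u=M|u|^p\operatorname{dist}(\cdot,\partial\Omega)^{-\alpha}\,d\mathcal{L}^n\quad\text{in }\Omega,\qquad u=0\quad\text{on }\partial\Omega.$$ (i) If $p-\alpha>n-2$, then $u$ is globally Lipschitz with the estimate, for all $x\in\Omega$, $$|u(x)|\le C(n,\Omega,\alpha,p)\,\operatorname{dist}(x,\partial\Omega)\,\|u\|_{L^\infty(\Omega)}.$$ (ii) If $p-\alpha=n-2$, then $u$ is globally log-Lipschitz with correction of order $\frac{n}{2-\alpha}$, with the estimate, for all $x\in\Omega$, $$|u(x)|\le C(n,\Omega,\alpha,p,M)\,\operatorname{dist}(x,\partial\Omega)\Big(1+|\log\operatorname{dist}(x,\partial\Omega)|^{\frac{n}{2-\alpha}}\Big).$$ (iii) If $p-\alpha<n-2$, then for every $\beta\in\big(0,\frac{2-\alpha}{n-p}\big)$ and all $x\in\Omega$, $$|u(x)|\le C(n,\Omega,\alpha,M,p,\beta)\,\operatorname{dist}(x,\partial\Omega)^{\beta}.$$ (iv) If $n(\alpha-1)-2<p-\alpha<n-2$, then for all $x\in\Omega$, $$|u(x)|\le C(n,\Omega,\alpha,M,p)\,\operatorname{dist}(x,\partial\Omega)^{\frac{2-\alpha}{n-p}}.$$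
   Context: $C(\ast,\ldots,\star)$ denotes a positive constant depending only on the quantities in the parentheses (in particular not on $u$ or $x$); it may differ from one occurrence to another. $\mathcal{L}^n$ is $n$-dimensional Lebesgue measure. For a convex function $u$ on a convex domain $\Omega\subset\mathbb{R}^n$, the subdifferential at $x\in\Omega$ is $\partial u(x)=\{q\in\mathbb{R}^n: u(y)\ge u(x)+q\cdot(y-x)\ \text{for all }y\in\Omega\}$, and the Monge--Ampère measure of $u$ is $\mu_u(E)=|\bigcup_{x\in E}\partial u(x)|$ for Borel $E\subset\Omega$. ''Globally Lipschitz'' means $u\in C^{0,1}(\overline\Omega)$. In (ii), ''globally log-Lipschitz with correction of order $\frac{n}{2-\alpha}$'' refers to the displayed estimate. *)

(* Defs.v *)
From HB Require Import structures.
From mathcomp Require Import all_boot all_order all_algebra.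
From mathcomp Require Import all_classical all_reals all_analysis.

Set Implicit Arguments.
Unset Strict Implicit.
Unset Printing Implicit Defensive.
Import Order.TTheory GRing.Theory Num.Theory.
Import numFieldNormedType.Exports.
Local Open Scope classical_set_scope.
Local Open Scope ring_scope.

(* The library norm on 'rV[R]_n is the sup norm; it induces the right topology
   and bounded sets, but distances and slopes below are Euclidean. *)
Definition dotp (R : realType) (n : nat) (x y : 'rV[R]_n) : R :=
  \sum_(i < n) x 0 i * y 0 i.

Definition enorm (R : realType) (n : nat) (x : 'rV[R]_n) : R :=
  Num.sqrt (dotp x x).

Definition frontier (T : topologicalType) (A : set T) : set T :=
  closure A `\` interior A.

Definition dist_frontier (R : realType) (n : nat) (Omega : set 'rV[R]_n)
    (x : 'rV[R]_n) : R :=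
  inf [set enorm (x - y) | y in frontier Omega].

Definition bounded_convex_domain (R : realType) (n : nat)
    (Omega : set 'rV[R]_n) : Prop :=
  [/\ open Omega, Omega !=set0, bounded_set Omega &
      @convex_set R 'rV[R]_n Omega].

Definition box (R : realType) (n : nat) (a b : 'rV[R]_n) : set 'rV[R]_n :=
  [set x | forall i, a 0 i < x 0 i <= b 0 i].

Definition box_volume (R : realType) (n : nat) (a b : 'rV[R]_n) : R :=
  \prod_(i < n) (b 0 i - a 0 i).

(* (D, a, b) stands for the countable family of boxes ]a k, b k], k in D.  The
   index set D may be empty, so that the empty set has a cover even for n = 0. *)
Definition box_cover (R : realType) (n : nat) (A : set 'rV[R]_n)
    (F : set nat * (nat -> 'rV[R]_n) * (nat -> 'rV[R]_n)) : Prop :=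
  (forall k i, F.1.1 k -> F.1.2 k 0 i <= F.2 k 0 i) /\
  A `<=` \bigcup_(k in F.1.1) box (F.1.2 k) (F.2 k).

Definition cover_volume (R : realType) (n : nat)
    (F : set nat * (nat -> 'rV[R]_n) * (nat -> 'rV[R]_n)) : \bar R :=
  (\esum_(k in F.1.1) (box_volume (F.1.2 k) (F.2 k))%:E)%E.

Definition lebesgue_outer (R : realType) (n : nat) (A : set 'rV[R]_n) : \bar R :=
  ereal_inf [set cover_volume F | F in box_cover A].

Section lebesgue_outer_measure.
Context (R : realType) (n : nat).
Local Open Scope ereal_scope.
Implicit Types A : set 'rV[R]_n.

Let vol_ge0 A F : box_cover A F -> forall k, F.1.1 k ->
  0 <= (box_volume (F.1.2 k) (F.2 k))%:E.
Proof.
move=> [ab _] k Dk; rewrite lee_fin; apply: prodr_ge0 => i _.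
by rewrite subr_ge0; exact: ab.
Qed.

Let lebesgue_outer_ge0 A : 0 <= lebesgue_outer A.
Proof.
apply: le_ereal_inf_tmp => _ [F cF <-]; apply: esum_ge0 => k Dk.
exact: vol_ge0 cF _ Dk.
Qed.

Let lebesgue_outer0 : lebesgue_outer (set0 : set 'rV[R]_n) = 0.
Proof.
apply/eqP; rewrite eq_le lebesgue_outer_ge0 andbT.
apply: ereal_inf_lbound; exists (set0, fun=> 0%R, fun=> 0%R).
  by split => //= k i.
by rewrite /cover_volume esum_set0.
Qed.

Let le_lebesgue_outer :
  {homo @lebesgue_outer R n : A B / A `<=` B >-> A <= B}.
Proof.
move=> A B AB; apply/ereal_inf_le_tmp => _ [F [F1 F2] <-].
by exists F => //; split => //; exact: subset_trans F2.
Qed.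

Let lebesgue_outer_sigma_subadditive :
  sigma_subadditive (@lebesgue_outer R n).
Proof.
move=> A; have [[i ioo]|] := pselect (exists i, lebesgue_outer (A i) = +oo).
  rewrite (eseries_pinfty _ _ ioo) ?leey// => k _.
  by rewrite -ltNye (lt_le_trans _ (lebesgue_outer_ge0 _)).
rewrite -forallNE => Aoo.
apply/lee_addgt0Pr => e e0.
apply: (le_trans _ (epsilon_trick _ _ (ltW e0))); last first.
  by move=> k; exact: lebesgue_outer_ge0.
pose P k F := box_cover (A k) F /\
  cover_volume F <= lebesgue_outer (A k) + (e / (2 ^ k.+1)%:R)%:E.
have [G PG] : {G : nat -> _ & forall k, P k (G k)}.
  apply: (@choice _ _ P) => k.
  have fA : lebesgue_outer (A k) \is a fin_num.
    by rewrite ge0_fin_numE// ltey; apply/eqP; exact: Aoo.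
  have e1 : (0 < e / (2 ^ k.+1)%:R)%R by rewrite divr_gt0.
  have [x [F cF <-] Fx] := lb_ereal_inf_adherent e1 fA.
  by exists F; split => //; exact: ltW.
have /card_esym/ppcard_eqP[f] := card_nat2.
pose D := [set m | (G (f m).1).1.1 (f m).2].
pose F : set nat * (nat -> 'rV[R]_n) * (nat -> 'rV[R]_n) :=
  (D, (fun m => (G (f m).1).1.2 (f m).2), (fun m => (G (f m).1).2 (f m).2)).
have cF : box_cover (\bigcup_k A k) F.
  split=> [m i /= Dm|x [k _ Akx]]; first by have [[+ _] _] := PG (f m).1; apply.
  have [[_ /(_ _ Akx)[j Dj xj]] _] := PG k.
  by exists (f^-1%FUN (k, j)); rewrite /= /D/= invK ?inE.
apply: (@le_trans _ _ (cover_volume F)).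
  by apply: ereal_inf_lbound; exists F.
pose w (z : nat * nat) : \bar R :=
  if z.2 \in (G z.1).1.1 then (box_volume ((G z.1).1.2 z.2) ((G z.1).2 z.2))%:E
  else 0.
have w0 z : 0 <= w z.
  rewrite /w; case: ifPn => //; rewrite inE => Dz.
  exact: vol_ge0 (PG z.1).1 _ Dz.
have -> : cover_volume F = \esum_(m in [set: nat]) w (f m).
  rewrite /cover_volume esum_mkcond; apply: eq_esum => m _.
  by rewrite /w /= /D; congr (if _ then _ else _); apply/idP/idP; rewrite !inE.
have bf : set_bij [set: nat] [set: nat * nat] f.
  exact: bij.
rewrite -(reindex_esum _ _ _ w bf).
have -> : [set: nat * nat] = [set: nat] `*`` (fun=> [set: nat]).
  by apply/seteqP; split.
rewrite -(@esum_esum _ _ _ _ _ (fun i j => w (i, j)))//.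
rewrite -nneseries_esumT; last by move=> k; exact: esum_ge0.
apply: lee_nneseries => [k _ _|k _]; first exact: esum_ge0.
apply: le_trans (PG k).2.
by rewrite /cover_volume [leRHS]esum_mkcond.
Qed.

HB.instance Definition _ := isOuterMeasure.Build R 'rV[R]_n
  (@lebesgue_outer R n) lebesgue_outer0 lebesgue_outer_ge0 le_lebesgue_outer
  lebesgue_outer_sigma_subadditive.

End lebesgue_outer_measure.

(* 'rV[R]_n with the sigma-algebra of Lebesgue (Caratheodory) measurable sets;
   leb n is the complete Lebesgue measure on it. *)
Definition lebesgue_space (R : realType) (n : nat) : Type :=
  caratheodory_type (@lebesgue_outer R n).

HB.instance Definition _ (R : realType) (n : nat) :=
  Measurable.on (lebesgue_space R n).

Definition leb (R : realType) (n : nat) : set (lebesgue_space R n) -> \bar R :=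
  @lebesgue_outer R n.

HB.instance Definition _ (R : realType) (n : nat) :=
  isMeasure.Build _ (lebesgue_space R n) R (@leb R n)
    (caratheodory_measure0 (@lebesgue_outer R n))
    (caratheodory_measure_ge0 (mu := @lebesgue_outer R n))
    (@caratheodory_measure_sigma_additive _ _ (@lebesgue_outer R n)).

Definition Linfty_norm (R : realType) (n : nat) (Omega : set 'rV[R]_n)
    (u : 'rV[R]_n -> R) : \bar R :=
  Lnorm (@leb R n) +oo%E ((EFin \o u) \_ Omega).

Definition borel (T : topologicalType) : set (set T) := <<s @open T >>.

Definition subdifferential (R : realType) (n : nat) (Omega : set 'rV[R]_n)
    (u : 'rV[R]_n -> R) (x : 'rV[R]_n) : set 'rV[R]_n :=
  [set q | forall y, Omega y -> u x + dotp q (y - x) <= u y].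

(* Borel sets have Lebesgue measurable subdifferential images, so the outer
   measure is the Lebesgue measure wherever this is used. *)
Definition monge_ampere (R : realType) (n : nat) (Omega : set 'rV[R]_n)
    (u : 'rV[R]_n -> R) (E : set 'rV[R]_n) : \bar R :=
  lebesgue_outer (\bigcup_(x in E) subdifferential Omega u x).

(* u is a total function, but only its values on the closure of Omega matter. *)
Definition convex_solution (R : realType) (n : nat) (Omega : set 'rV[R]_n)
    (alpha p M : R) (u : 'rV[R]_n -> R) : Prop :=
  [/\ {within closure Omega, continuous u},
      @convex_function R 'rV[R]_n Omega u,
      forall E, borel E -> E `<=` Omega ->
        monge_ampere Omega u E =
        (\int[@leb R n]_(x in E)
          (M * `|u x| `^ p * dist_frontier Omega x `^ (- alpha))%:E)%E &
      forall x, frontier Omega x -> u x = 0].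

Definition nonzero_on (R : realType) (n : nat) (A : set 'rV[R]_n)
    (u : 'rV[R]_n -> R) : Prop :=
  exists2 x, A x & u x != 0.

Definition lipschitz_on_set (R : realType) (n : nat) (A : set 'rV[R]_n)
    (u : 'rV[R]_n -> R) : Prop :=
  exists L : R, forall x y, A x -> A y -> `|u x - u y| <= L * enorm (x - y).

(* Main.v *)
Require Import Defs.
From mathcomp Require Import all_boot all_order all_algebra.
From mathcomp Require Import all_classical all_reals all_analysis.
From mathcomp Require Import measurable_realfun.
From mathcomp Require Import ring lra zify.
Set Implicit Arguments.
Unset Strict Implicit.
Unset Printing Implicit Defensive.
Import Order.TTheory GRing.Theory Num.Theory.
Import numFieldNormedType.Exports.
Local Open Scope classical_set_scope.
Local Open Scope ring_scope.

(** Write d for the distance to the frontier. The four estimates all come from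
    one family of barriers, namely powers d^a bent slightly in all directions:

      f = A d - sgn(a - 1) d^a (1 + sgn(a - 1) delta |x|^2),   a <> 1,

    where A = 0 if a < 1 and A is large if a > 1. The function d need be
    neither differentiable nor strictly concave. It suffices that near a point
    x0 it lies below the distance to the supporting hyperplane at the nearest
    frontier point ([dist_support]), with equality at x0. Replacing d by this
    affine function and expanding to second order shows that f lies below an
    affine function minus c |a - 1| d(x0)^a (|h|^2 + (nu.h)^2 / d(x0)^2), with
    h = x - x0 ([barrier_local]). Morally det D^2(-f) is at least
    c |a - 1|^n d^(n a - 2).

    A comparison principle that works for such f is obtained at a single
    contact point. Suppose that a convex u touches from above at x0 a function
    u(x0) + L.h + B (|h|^2 + (nu.h)^2 / rho^2). On the set
    E = {|h| < r, |nu.h| < r rho} the subgradients of u fill L plus the set of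
    all b + theta nu with |b| < B r / 2 and |theta| < B r / (2 rho), and this
    set contains about 1 / (4 rho^2) disjoint translates of (B / 2) E. Hence
    the Monge-Ampere measure of E is at least c B^n rho^(-2) |E|, which bounds
    B by the density of the measure ([quadratic_touching_bound]). Only
    translations, dilations and disjointness enter: no determinant and no
    change of variables.

    Consequently, if |u| <= K d^b, then the density M |u|^p d^(-alpha) is at
    most M K^p d^(p b - alpha), and for every a with n a - 2 <= p b - alpha

      |u| <= C |a - 1|^(-1) (M K^p)^(1/n) f        ([decay_barrier]).

    This self-improvement is used in two ways.

    Starting from b = 0 and K = m = max |u|, finitely many steps reach every
    b < 1 with n b < 2 - alpha + p b, with a constant C m ([subcritical_decay]).
    Here M m^p <= C m^n is needed, and it holds since on a fixed ball the
    measure is at least c M m^p, while subgradients there are at most C m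
    ([mass_bound]). If p - alpha > n - 2, then one last step with some a > 1
    gives |u| <= C m d ([linear_decay]), and the Lipschitz bound follows by
    convexity along lines.

    If p < n, let K be the best constant for an exponent b as above. It is
    finite by the previous paragraph, and the step with a = b gives
    K <= C (1 - b)^(-1) (M K^p)^(1/n), that is,
    K <= (C / (1 - b))^(n / (n - p)) uniformly in b ([sharp_power_decay]).
    Letting b tend to the critical exponent (2 - alpha) / (n - p), at the rate
    1 / |log d(x)|, costs only a bounded factor. If the critical exponent is
    less than 1, this gives the sharp power ([critical_decay]). If it equals
    1, the factor (1 - b)^(-n / (n - p)) becomes the power n / (2 - alpha) of
    the logarithm ([log_decay]). *)

(** * Lebesgue outer measure of boxes, translates and dilates *)

(** Induction on the dimension. The boxes that meet the hyperplane where the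
    last coordinate is y have slices that cover a cube of one dimension less.
    Integrating the bound for these slices over y in ]0, 1] multiplies the
    volume of each slice by the length of the last side of its box. *)
Lemma unit_cube_cover_ge1 (R : realType) (n : nat) :
  forall (P : pred nat) (a b : nat -> nat -> R),
  (forall k i, P k -> a k i <= b k i) ->
  (forall x : nat -> R, (forall i, 0 < x i <= 1) ->
    exists2 k, P k & forall i, (i < n)%N -> a k i < x i <= b k i) ->
  (1 <= \sum_(0 <= k <oo)
    (if P k then \prod_(i < n) (b k i - a k i) else 0)%:E)%E.
Proof.
elim: n => [|n IH] P a b ab cov.
  have [k Pk _] := cov (fun=> 1) (fun i => ltac:(by rewrite ltr01 lexx)).
  apply: le_trans (nneseries_lim_ge k.+1 _); last first.
    by move=> j _ _; rewrite lee_fin; case: ifP => // _; rewrite big_ord0.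
  rewrite big_nat_recr//= Pk big_ord0 leeDr//.
  apply: sume_ge0 => j _; rewrite lee_fin.
  by case: ifP => // _; rewrite big_ord0.
pose c k : R := if P k then \prod_(i < n) (b k i - a k i) else 0.
have c0 k : 0 <= c k.
  rewrite /c; case: ifP => // Pk; apply: prodr_ge0 => i _.
  by rewrite subr_ge0 ab.
pose I k : set R := `]a k n, b k n]%classic.
have slice y : 0 < y <= 1 ->
    (1 <= \sum_(0 <= k <oo) (c k * \1_(I k) y)%:E)%E.
  move=> y01.
  have E k : (if P k && (y \in I k) then
      \prod_(i < n) (b k i - a k i) else 0)%:E = (c k * \1_(I k) y)%:E.
    congr EFin; rewrite /c indicE.
    by case: (P k); case: (y \in I k) => //=; rewrite ?mulr1 ?mulr0 ?mul0r.
  rewrite -(eq_eseriesr (fun k _ => E k)).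
  apply: IH => [k i /andP[Pk _]|x x01]; first exact: ab.
  (* Points of the slice are extended by y in coordinate n. *)
  have x'01 i : 0 < (if i == n then y else x i) <= 1 by case: ifP.
  have [k Pk kx] := cov _ x'01.
  exists k => [|i ni].
    rewrite Pk/= inE /I /= in_itv/=.
    by have := kx n (ltnSn n); rewrite eqxx.
  by have := kx i (ltnW ni); rewrite (ltn_eqF ni).
pose mu := @lebesgue_measure R.
have mI k : measurable (I k) by exact: measurable_itv.
have mU : measurable `]0%R, 1%R :> R]%classic by exact: measurable_itv.
have mI1 k : measurable_fun setT (EFin \o (\1_(I k) : R -> R)).
  by apply/measurable_EFinP; exact: measurable_indic.
have -> : (\sum_(0 <= k <oo)
    (if P k then \prod_(i < n.+1) (b k i - a k i) else 0)%:E =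
    \sum_(0 <= k <oo) \int[mu]_y (c k * \1_(I k) y)%:E)%E.
  apply: eq_eseriesr => k _.
  under eq_integral do rewrite EFinM.
  rewrite ge0_integralZl//; [|exact: mI1|by rewrite lee_fin].
  rewrite integral_indic//; last exact: mI.
  rewrite setIT [X in (_ * X)%E](lebesgue_measure_itv `]a k n, b k n]) /= lte_fin.
  rewrite /c; case: ifP => Pk; last by rewrite mul0e.
  rewrite big_ord_recr/=; case: ltP => abk; first by rewrite EFinM -EFinB.
  have -> : b k n = a k n by apply/eqP; rewrite eq_le abk ab.
  by rewrite subrr mulr0 mule0.
rewrite -integral_nneseries//; last first.
- by move=> k y _; rewrite lee_fin mulr_ge0.
- move=> k; exact: (measurable_funeM (c k)%:E (mI1 k)).
pose S (y : R) : \bar R := (\sum_(0 <= k <oo) (c k * \1_(I k) y)%:E)%E.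
have mS : measurable_fun setT S.
  apply: ge0_emeasurable_sum => [k y _ _|k _].
    by rewrite lee_fin mulr_ge0.
  exact: (measurable_funeM (c k)%:E (mI1 k)).
apply: (@le_trans _ _ (\int[mu]_(y in `]0%R, 1%R]) (cst 1%E y))%E).
  rewrite integral_cst// mul1e.
  by rewrite [leRHS](lebesgue_measure_itv `]0, 1])/= lte_fin ltr01 oppr0 adde0.
apply: (@le_trans _ _ (\int[mu]_(y in `]0%R, 1%R])
   (\sum_(0 <= k <oo) (c k * \1_(I k) y)%:E))%E).
  apply: ge0_le_integral => //.
  exact: measurable_funS measurableT (@subsetT _ _) mS.
apply: ge0_subset_integral => //.
by move=> y _; apply: nneseries_ge0 => k _ _; rewrite lee_fin mulr_ge0.
Qed.

Lemma box_cover_vol_ge0 (R : realType) (n : nat) (A : set 'rV[R]_n) F :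
  box_cover A F -> forall k, F.1.1 k ->
  (0 <= (box_volume (F.1.2 k) (F.2 k))%:E)%E.
Proof.
move=> [ab _] k Dk; rewrite lee_fin; apply: prodr_ge0 => i _.
by rewrite subr_ge0; exact: ab.
Qed.

Lemma le_lebesgue_outer (R : realType) (n : nat) (A B : set 'rV[R]_n) :
  A `<=` B -> (lebesgue_outer A <= lebesgue_outer B)%E.
Proof. exact: (le_outer_measure (@lebesgue_outer R n)). Qed.

Lemma lebesgue_outer_le_cover (R : realType) (n : nat) (A : set 'rV[R]_n) F :
  box_cover A F -> (lebesgue_outer A <= cover_volume F)%E.
Proof. by move=> cF; apply: ereal_inf_lbound; exists F. Qed.

Lemma lebesgue_outer_box_le (R : realType) (n : nat) (a b : 'rV[R]_n) :
  (forall i, a 0 i <= b 0 i) ->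
  (lebesgue_outer (box a b) <= (box_volume a b)%:E)%E.
Proof.
move=> ab.
have cF : box_cover (box a b) ([set 0%N], (fun=> a), (fun=> b)).
  by split=> [k i _|x xab]; [exact: ab|exists 0%N].
apply: le_trans (lebesgue_outer_le_cover cF) _.
rewrite /cover_volume/= esum_set1//.
exact: (box_cover_vol_ge0 cF (k := 0%N)).
Qed.

Lemma cover_volumeE (R : realType) (n : nat) (A : set 'rV[R]_n) F :
  box_cover A F -> cover_volume F =
  (\sum_(0 <= k <oo) (if k \in F.1.1 then
      \prod_(i < n) (F.2 k 0 i - F.1.2 k 0 i) else 0)%:E)%E.
Proof.
move=> cF; rewrite nneseries_esumT.
  rewrite /cover_volume esum_mkcond; apply: eq_esum => k _.
  by case: ifP.
move=> k; case: ifPn => // /[1!inE] Dk; exact: (box_cover_vol_ge0 cF Dk).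
Qed.

Lemma lebesgue_outer_unit_cube_ge1 (R : realType) (n : nat) :
  (1 <= lebesgue_outer (box (0 : 'rV[R]_n) (const_mx 1%R)))%E.
Proof.
apply: le_ereal_inf_tmp => _ [F cF <-]; rewrite (cover_volumeE cF).
(* Coordinates with index at least n are set to 0. *)
pose e (v : nat -> 'rV[R]_n) (k i : nat) : R :=
  if insub i is Some j then v k 0 (j : 'I_n) else 0.
have eE v k (i : 'I_n) : e v k i = v k 0 i.
  by rewrite /e; case: insubP => [j _ /val_inj->|/negP[]//].
have E k : (if k \in F.1.1 then \prod_(i < n) (F.2 k 0 i - F.1.2 k 0 i)
     else 0)%:E = (if k \in F.1.1 then \prod_(i < n)
       (e F.2 k i - e F.1.2 k i) else 0)%:E :> \bar R.
  by case: ifP => // _; congr EFin; apply: eq_bigr => i _; rewrite !eE.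
rewrite (eq_eseriesr (fun k _ => E k)).
apply: (unit_cube_cover_ge1 (P := fun k => k \in F.1.1)) => [k i|x x01].
  rewrite inE => Dk; rewrite /e; case: insubP => // j _ _; exact: cF.1.
have /cF.2[k Dk xk] : box 0 (const_mx 1) (\row_(i < n) x i).
  by move=> i; rewrite !mxE.
exists k => [|i ni]; first by rewrite inE.
by have := xk (Ordinal ni); rewrite mxE -!eE.
Qed.

Lemma lebesgue_outer_affine_le (R : realType) (n : nat) (c : 'rV[R]_n) (s : R)
    (A : set 'rV[R]_n) : 0 < s ->
  (lebesgue_outer [set (c + s *: y)%R | y in A] <=
     (s ^+ n)%:E * lebesgue_outer A)%E.
Proof.
move=> s0; have sn0 : 0 < s ^+ n by exact: exprn_gt0.
rewrite -lee_pdivrMl//; apply: le_ereal_inf_tmp => _ [F cF <-].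
rewrite lee_pdivrMl//.
pose F' : set nat * (nat -> 'rV[R]_n) * (nat -> 'rV[R]_n) :=
  (F.1.1, (fun k => c + s *: F.1.2 k), (fun k => c + s *: F.2 k)).
have cF' : box_cover [set (c + s *: y)%R | y in A] F'.
  split=> [k i /= Dk|_ [y Ay <-]].
    by rewrite !mxE lerD2l ler_pM2l//; exact: cF.1.
  have [k Dk yk] := cF.2 _ Ay; exists k => // i.
  by rewrite !mxE ltrD2l lerD2l ltr_pM2l// ler_pM2l//; exact: yk.
apply: le_trans (lebesgue_outer_le_cover cF') _.
rewrite (cover_volumeE cF) (cover_volumeE cF').
rewrite -nneseriesZl//=.
  apply: lee_nneseries => [k _ _|k _].
    case: ifPn => // /[1!inE] Dk; exact: (box_cover_vol_ge0 cF' Dk).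
  rewrite -EFinM lee_fin; case: ifP => _; last by rewrite mulr0.
  rewrite -[X in s ^+ X](card_ord n) -prodr_const -big_split/=.
  rewrite le_eqVlt; apply/orP; left; apply/eqP; apply: eq_bigr => i _.
  by rewrite !mxE; ring.
move=> k _; case: ifPn => // /[1!inE] Dk; exact: (box_cover_vol_ge0 cF Dk).
Qed.

Lemma lebesgue_outer_affine (R : realType) (n : nat) (c : 'rV[R]_n) (s : R)
    (A : set 'rV[R]_n) : 0 < s ->
  lebesgue_outer [set (c + s *: y)%R | y in A] =
     ((s ^+ n)%:E * lebesgue_outer A)%E.
Proof.
move=> s0; apply/eqP; rewrite eq_le lebesgue_outer_affine_le//=.
have sn0 : 0 < s ^+ n by exact: exprn_gt0.
rewrite -lee_pdivlMl//.
have := lebesgue_outer_affine_le (- s^-1 *: c) [set c + s *: y | y in A]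
  (s := s^-1).
rewrite invr_gt0 -exprVn => /(_ s0); congr (lebesgue_outer _ <= _)%E.
rewrite image_comp; apply/seteqP; split => [_ [y Ay <-]|y Ay] /=.
  rewrite scalerDr addrA scaleNr addNr add0r scalerA mulVf ?gt_eqF//.
  by rewrite scale1r.
exists y => //.
rewrite scalerDr addrA scaleNr addNr add0r scalerA mulVf ?gt_eqF//.
by rewrite scale1r.
Qed.

Lemma lebesgue_outer_cube_gt0 (R : realType) (n : nat) (c : 'rV[R]_n) (s : R)
    (A : set 'rV[R]_n) : 0 < s ->
  (forall y : 'rV[R]_n, (forall i, c 0 i < y 0 i <= c 0 i + s) -> A y) ->
  (0 < lebesgue_outer A)%E.
Proof.
move=> s0 cA; pose Q := box (0 : 'rV[R]_n) (const_mx 1).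
have QA : [set (c + s *: y)%R | y in Q] `<=` A.
  move=> _ [y Qy <-]; apply: cA => i; have := Qy i.
  rewrite !mxE => /andP[y0 y1].
  by rewrite ltrDl lerD2l mulr_gt0//= -[leRHS]mulr1 ler_pM2l.
apply: lt_le_trans (le_lebesgue_outer QA).
rewrite lebesgue_outer_affine// mule_gt0// ?lte_fin ?exprn_gt0//.
by apply: lt_le_trans (lebesgue_outer_unit_cube_ge1 R n).
Qed.

Lemma lebesgue_outer_bounded (R : realType) (n : nat) (A : set 'rV[R]_n) (D : R) :
  0 <= D -> (forall y, A y -> forall i, `|y 0 i| < D) ->
  (lebesgue_outer A <= ((2 * D) ^+ n)%:E)%E.
Proof.
move=> D0 AD; have AB : A `<=` box (const_mx (- D)) (const_mx D).
  move=> y Ay i; have := AD _ Ay i; rewrite ltr_norml !mxE => /andP[-> /ltW].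
  by [].
apply: le_trans (le_lebesgue_outer AB) _.
apply: le_trans (lebesgue_outer_box_le _) _ => [i|].
  by rewrite !mxE; lra.
rewrite lee_fin /box_volume.
under eq_bigr do rewrite !mxE opprK -mulr2n -mulr_natl.
by rewrite prodr_const card_ord.
Qed.

(** The hyperplane cuts every box of a cover into two boxes of the same total
    volume, which yields covers of the two parts of the covered set. *)
Lemma halfspace_caratheodory (R : realType) (n : nat) (i : 'I_n) (c : R) :
  (@lebesgue_outer R n).-caratheodory [set x : 'rV[R]_n | x 0 i <= c].
Proof.
apply: le_caratheodory_measurable => X.
apply: le_ereal_inf_tmp => _ [F cF <-].
pose upd (v : 'rV[R]_n) (r : R) : 'rV[R]_n :=
  \row_j (if j == i then r else v 0 j).
(* The clamped height at which box k is cut. *)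
pose m k := Num.max (F.1.2 k 0 i) (Num.min (F.2 k 0 i) c).
have mP k : F.1.1 k -> F.1.2 k 0 i <= m k <= F.2 k 0 i.
  move=> Dk; rewrite /m le_max lexx/= ge_max cF.1//=.
  by rewrite ge_min lexx.
pose F1 : set nat * (nat -> 'rV[R]_n) * (nat -> 'rV[R]_n) :=
  (F.1.1, F.1.2, (fun k => upd (F.2 k) (m k))).
pose F2 : set nat * (nat -> 'rV[R]_n) * (nat -> 'rV[R]_n) :=
  (F.1.1, (fun k => upd (F.1.2 k) (m k)), F.2).
have cF1 : box_cover (X `&` [set x | x 0 i <= c]) F1.
  split=> [k j Dk|x [/cF.2[k Dk xk] /= xc]].
    rewrite /= mxE; case: eqP => [->|_]; last exact: cF.1.
    by case/andP: (mP k Dk).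
  exists k => // j; rewrite mxE; have := xk j; case: eqP => [->|//].
  by rewrite /m le_max le_min xc => /andP[-> ->]; rewrite /= orbT.
have cF2 : box_cover (X `&` ~` [set x | x 0 i <= c]) F2.
  split=> [k j Dk|x [/cF.2[k Dk xk] /= /negP]].
    rewrite /= mxE; case: eqP => [->|_]; last exact: cF.1.
    by case/andP: (mP k Dk).
  rewrite -ltNge => xc; exists k => // j; rewrite mxE.
  have := xk j; case: eqP => [->|//].
  by rewrite /m gt_max gt_min xc orbT => /andP[-> ->].
apply: le_trans (leeD (lebesgue_outer_le_cover cF1)
  (lebesgue_outer_le_cover cF2)) _.
rewrite /cover_volume -esumD/=; last 2 first.
  exact: box_cover_vol_ge0 cF1.
  exact: box_cover_vol_ge0 cF2.
rewrite le_eqVlt; apply/orP; left; apply/eqP; apply: eq_esum => k Dk.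
rewrite -EFinD; congr EFin.
have volD (v w : 'rV[R]_n) : box_volume v w =
    (w 0 i - v 0 i) * \prod_(j < n | j != i) (w 0 j - v 0 j).
  by rewrite /box_volume (bigD1 i).
rewrite !volD !mxE eqxx.
have E1 : \prod_(j < n | j != i) (upd (F.2 k) (m k) 0 j - F.1.2 k 0 j) =
  \prod_(j < n | j != i) (F.2 k 0 j - F.1.2 k 0 j).
  by apply: eq_bigr => j /negbTE ji; rewrite mxE ji.
have E2 : \prod_(j < n | j != i) (F.2 k 0 j - upd (F.1.2 k) (m k) 0 j) =
  \prod_(j < n | j != i) (F.2 k 0 j - F.1.2 k 0 j).
  by apply: eq_bigr => j /negbTE ji; rewrite mxE ji.
by rewrite E1 E2; ring.
Qed.

Lemma box_measurable (R : realType) (n : nat) (a b : 'rV[R]_n) :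
  measurable (box a b : set (lebesgue_space R n)).
Proof.
have -> : box a b = \bigcap_(i in [set: 'I_n])
    ([set x : 'rV[R]_n | x 0 i <= b 0 i] `\` [set x | x 0 i <= a 0 i]).
  apply/seteqP; split => [x xab i _|x xab i].
    by have /andP[ax xb] := xab i; split => //=; apply/negP; rewrite -ltNge.
  by have [/= -> /negP] := xab i I; rewrite -ltNge => ->.
apply: (@fin_bigcap_measurable _ (lebesgue_space R n)) => // i _.
apply: (@measurableD _ (lebesgue_space R n)); exact: halfspace_caratheodory.
Qed.

(** * Euclidean norm, open sets and integrals *)

Section euclid.
Variables (R : realType) (n : nat).
Implicit Types x y z : 'rV[R]_n.

Lemma dotpC x y : dotp x y = dotp y x.
Proof. by apply: eq_bigr => i _; rewrite mulrC. Qed.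

Lemma dotpDl x y z : dotp (x + y) z = dotp x z + dotp y z.
Proof. by rewrite -big_split; apply: eq_bigr => i _; rewrite mxE mulrDl. Qed.

Lemma dotpZl c x y : dotp (c *: x) y = c * dotp x y.
Proof. by rewrite mulr_sumr; apply: eq_bigr => i _; rewrite mxE mulrA. Qed.

Lemma dotpDr x y z : dotp z (x + y) = dotp z x + dotp z y.
Proof. by rewrite dotpC dotpDl !(dotpC z). Qed.

Lemma dotpZr c x y : dotp x (c *: y) = c * dotp x y.
Proof. by rewrite dotpC dotpZl (dotpC x). Qed.

Lemma dotpNl x y : dotp (- x) y = - dotp x y.
Proof. by rewrite -scaleN1r dotpZl mulN1r. Qed.

Lemma dotpNr x y : dotp x (- y) = - dotp x y.
Proof. by rewrite dotpC dotpNl dotpC. Qed.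

Lemma dotp0l y : dotp 0 y = 0.
Proof. by rewrite -(scale0r 0) dotpZl mul0r. Qed.

Definition dotpE := (dotpDl, dotpDr, dotpZl, dotpZr, dotpNl, dotpNr).

Lemma dotp_ge0 x : 0 <= dotp x x.
Proof. by apply: sumr_ge0 => i _; rewrite -expr2 sqr_ge0. Qed.

Lemma enorm_ge0 x : 0 <= enorm x. Proof. exact: sqrtr_ge0. Qed.

Lemma sqr_enorm x : enorm x ^+ 2 = dotp x x.
Proof. by rewrite sqr_sqrtr// dotp_ge0. Qed.

Lemma normr_coord_le x i : `|x 0 i| <= enorm x.
Proof.
rewrite -sqrtr_sqr ler_wsqrtr// /dotp (bigD1 i)//= expr2 lerDl.
by apply: sumr_ge0 => j _; rewrite -expr2 sqr_ge0.
Qed.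

Lemma normr_le_enorm x : `|x| <= enorm x.
Proof.
rewrite [leLHS]/Num.Def.normr/= mx_normrE; apply/bigmax_leP.
by split=> [|[i j] _ /=]; rewrite ?enorm_ge0// ord1; exact: normr_coord_le.
Qed.

Lemma enorm_le_sum x (c : R) : 0 <= c -> (forall i, `|x 0 i| <= c) ->
  enorm x <= n%:R * c.
Proof.
move=> c0 xc; have nc0 : 0 <= n%:R * c by rewrite mulr_ge0.
rewrite -(ger0_norm nc0) -sqrtr_sqr ler_wsqrtr//.
apply: (@le_trans _ _ (\sum_(i < n) c ^+ 2)).
  apply: ler_sum => i _; rewrite -expr2 -real_normK ?num_real//.
  by rewrite lerXn2r ?nnegrE.
rewrite sumr_const card_ord exprMn -[leLHS]mulr_natl ler_wpM2r ?sqr_ge0//.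
by rewrite -natrX ler_nat; case: (n) => // k; rewrite leq_pmulr.
Qed.

Lemma enorm_eq0 x : (enorm x == 0) = (x == 0).
Proof.
apply/idP/eqP => [/eqP x0|->]; last by rewrite /enorm dotp0l sqrtr0.
by apply/eqP; rewrite -normr_le0 -x0 normr_le_enorm.
Qed.

Lemma enorm0 : enorm (0 : 'rV[R]_n) = 0.
Proof. by apply/eqP; rewrite enorm_eq0. Qed.

Lemma enormN x : enorm (- x) = enorm x.
Proof. by rewrite /enorm dotpNl dotpNr opprK. Qed.

Lemma enorm_sub x y : enorm (x - y) = enorm (y - x).
Proof. by rewrite -enormN opprB. Qed.

Lemma enormZ c x : enorm (c *: x) = `|c| * enorm x.
Proof.
by rewrite /enorm dotpZl dotpZr mulrA -expr2 sqrtrM ?sqr_ge0// sqrtr_sqr.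
Qed.

Lemma normr_dotp_le x y : `|dotp x y| <= enorm x * enorm y.
Proof.
have [->|x0] := eqVneq x 0.
  by rewrite dotp0l normr0 mulr_ge0 ?enorm_ge0.
have [->|y0] := eqVneq y 0.
  by rewrite dotpC dotp0l normr0 mulr_ge0 ?enorm_ge0.
have ex : 0 < enorm x by rewrite lt_neqAle eq_sym enorm_eq0 x0 enorm_ge0.
have ey : 0 < enorm y by rewrite lt_neqAle eq_sym enorm_eq0 y0 enorm_ge0.
have exy : 0 < enorm x * enorm y by rewrite mulr_gt0.
have := dotp_ge0 (enorm y *: x + enorm x *: y).
have := dotp_ge0 (enorm y *: x - enorm x *: y).
rewrite !dotpE -!sqr_enorm (dotpC y x) => h1 h2.
rewrite ler_norml -(ler_pM2l exy) -[X in _ && X](ler_pM2l exy).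
by apply/andP; split; nra.
Qed.

Lemma ler_enormD x y : enorm (x + y) <= enorm x + enorm y.
Proof.
have h : 0 <= enorm x + enorm y by rewrite addr_ge0 ?enorm_ge0.
rewrite -(ger0_norm h) -sqrtr_sqr ler_wsqrtr//.
rewrite !dotpE -!sqr_enorm (dotpC y x).
have := normr_dotp_le x y; rewrite ler_norml => /andP[_ H].
by rewrite sqrrD; lra.
Qed.

Lemma ler_enorm_dist z x y : enorm (x - y) <= enorm (x - z) + enorm (z - y).
Proof. by rewrite -[x - y](subrKA z) ler_enormD. Qed.

Lemma dotp_continuous x : continuous (dotp x : 'rV[R]_n -> R).
Proof.
apply: continuous_big => [|i _ y]; first exact: add_continuous.
apply: (@continuousM _ _ (fun=> x 0 i) (fun y : 'rV[R]_n => y 0 i)).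
  exact: cst_continuous.
exact: coord_continuous.
Qed.

Lemma enorm_continuous : continuous (@enorm R n).
Proof.
move=> y; apply: (@continuous_comp _ _ _ (fun x => dotp x x) Num.sqrt).
  move: y; apply: continuous_big => [|i _ y]; first exact: add_continuous.
  apply: (@continuousM _ _ (fun y : 'rV[R]_n => y 0 i)); exact: coord_continuous.
exact: sqrt_continuous.
Qed.

End euclid.

Section open_measurable.
Variables (R : realType) (n : nat).

Lemma open_enorm_ball (U : set 'rV[R]_n) x : open U -> U x ->
  exists2 e : R, 0 < e & forall y : 'rV[R]_n, (forall i, `|x 0 i - y 0 i| < e) -> U y.
Proof.
move=> oU Ux; have /nbhs_ballP[e /= e0 eU] := open_nbhs_nbhs (conj oU Ux).
exists e => // y xy; apply: eU; split=> // i j; rewrite ord1; exact: xy.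
Qed.

(** An open set is the union of the grid boxes, over all mesh sizes 1 / (m + 1),
    that it contains, and there are countably many of them. *)
Lemma open_lebesgue_measurable (U : set 'rV[R]_n) : open U ->
  measurable (U : set (lebesgue_space R n)).
Proof.
move=> oU.
pose B (m : nat * 'rV[int]_n) : set 'rV[R]_n :=
  box (\row_i ((m.2 0 i)%:~R / m.1.+1%:R))
      (\row_i (((m.2 0 i)%:~R + 1) / m.1.+1%:R)).
pose F m := if pselect (B m `<=` U) then B m else set0.
have -> : U = \bigcup_m F m.
  apply/seteqP; split => [x Ux|x [m _]]; last first.
    by rewrite /F; case: pselect => // BU; exact: BU.
  have [e e0 eU] := open_enorm_ball oU Ux.
  have [k ke] : exists k, k.+1%:R^-1 < e.
    have [k _ /(_ _ (leqnn k)) H] := near_infty_natSinv_lt (PosNum e0).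
    by exists k.
  exists (k, \row_i (Num.ceil (x 0 i * k.+1%:R) - 1)) => //.
  have k0 : 0 < k.+1%:R :> R by [].
  have xB : B (k, \row_i (Num.ceil (x 0 i * k.+1%:R) - 1)) x.
    move=> i; rewrite !mxE/= ltr_pdivrMr// ler_pdivlMr//.
    by have := ceil_itv (x 0 i * k.+1%:R); rewrite intrB subrK.
  rewrite /F; case: pselect => // -[] y yB; apply: eU => i.
  apply: le_lt_trans ke; have := xB i; have := yB i; rewrite !mxE/=.
  set a := _ / k.+1%:R; set b := (_ + 1) / _.
  have -> : b = a + k.+1%:R^-1 by rewrite /a /b mulrDl mul1r.
  move: (k.+1%:R^-1); clearbody a => r /andP[h1 h2] /andP[h3 h4].
  by rewrite ler_norml; apply/andP; split; lra.
apply: (@countable_bigcupT_measurable _ (lebesgue_space R n)).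
  exact: countableP.
move=> m; rewrite /F; case: pselect => BU; first exact: box_measurable.
exact: measurable0.
Qed.

(** Open sets are Caratheodory measurable, so the outer measure is additive on
    disjoint ones. *)
Lemma lebesgue_outer_disjoint (A : nat -> set 'rV[R]_n) (P : set 'rV[R]_n)
    (m : \bar R) (N : nat) :
  (forall k, open (A k)) -> trivIset setT A ->
  (forall k, (k < N)%N -> A k `<=` P) ->
  (forall k, (m <= lebesgue_outer (A k))%E) ->
  (m *+ N <= lebesgue_outer P)%E.
Proof.
move=> oA tA AP mA.
have UP : \big[setU/set0]_(i < N) A i `<=` P.
  by move=> x; rewrite -bigcup_mkord => -[k /= kN]; exact: AP.
apply: le_trans (le_lebesgue_outer UP).
have := caratheodory_additive (mu := @lebesgue_outer R n)
  (fun k => open_lebesgue_measurable (oA k)) tA N setT.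
rewrite setTI => /= ->.
under eq_bigr do rewrite setTI.
apply: (@le_trans _ _ (\sum_(i < N) m)%E); first by rewrite sumr_const card_ord.
by apply: lee_sum => i _; exact: mA.
Qed.

End open_measurable.

(** The integral of a nonnegative function is the supremum of the integrals of
    the simple functions below it, hence monotone for arbitrary functions. *)
Lemma ge0_le_integral_any d (T : measurableType d) (R : realType)
    (mu : {measure set T -> \bar R}) (D : set T) (f g : T -> \bar R) :
  (forall x, D x -> (0 <= f x)%E) -> (forall x, D x -> (f x <= g x)%E) ->
  (\int[mu]_(x in D) f x <= \int[mu]_(x in D) g x)%E.
Proof.
move=> f0 fg; have g0 x : D x -> (0 <= g x)%E.
  by move=> Dx; apply: le_trans (fg x Dx); exact: f0.
rewrite !ge0_integralE//; apply: ge_ereal_sup => _ [h hf <-].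
apply: ereal_sup_ubound; exists h => // x; apply: le_trans (hf x) _; rewrite /patch.
by case: ifP => // /[1!inE]; exact: fg.
Qed.

(** * Bounded convex domains and the distance to the frontier *)

Section enorm_topology.
Variables (R : realType) (n : nat).
Implicit Types (x y z : 'rV[R]_n) (U : set 'rV[R]_n).

Lemma open_enorm U x : open U -> U x ->
  exists2 e : R, 0 < e & forall y, enorm (x - y) < e -> U y.
Proof.
move=> oU Ux; have [e e0 eU] := open_enorm_ball oU Ux.
exists e => // y xy; apply: eU => i.
by have := normr_coord_le (x - y) i; rewrite !mxE => /le_lt_trans; apply.
Qed.

Lemma closure_enorm U x :
  (forall e : R, 0 < e -> exists2 y, U y & enorm (x - y) < e) -> closure U x.
Proof.
move=> H B; rewrite nbhsE => -[V [oV Vx] VB].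
have [e e0 eV] := open_enorm oV Vx.
by have [y Uy xy] := H e e0; exists y; split => //; apply: VB; exact: eV.
Qed.

Lemma open_enorm_lt (r : R) x : open [set y : 'rV[R]_n | enorm (y - x) < r].
Proof.
apply: (@open_comp _ _ (fun y => enorm (y - x)) [set t | t < r]).
  move=> y _; apply: (@continuous_comp _ _ _ (fun y => y - x) (@enorm R n)).
    by apply: continuousB; [exact: cvg_id|exact: cst_continuous].
  exact: enorm_continuous.
exact: open_lt.
Qed.

Lemma open_dotp_lt (r : R) v x :
  open [set y : 'rV[R]_n | `|dotp v (y - x)| < r].
Proof.
apply: (@open_comp _ _ (fun y => `|dotp v (y - x)|) [set t | t < r]).
  move=> y _; apply: (@continuous_comp _ _ _ (fun y => dotp v (y - x))
    (Num.Def.normr : R -> R)); last exact: norm_continuous.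
  apply: (@continuous_comp _ _ _ (fun y => y - x) (dotp v)).
    by apply: continuousB; [exact: cvg_id|exact: cst_continuous].
  exact: dotp_continuous.
exact: open_lt.
Qed.

End enorm_topology.

Section convex_domain.
Variables (R : realType) (n : nat) (Omega : set 'rV[R]_n).
Hypothesis hn : (0 < n)%N.
Hypothesis hO : bounded_convex_domain Omega.
Implicit Types x y z : 'rV[R]_n.
Local Notation d := (dist_frontier Omega).

Lemma domain_open : open Omega. Proof. by case: hO. Qed.

Lemma domain_conv x y (t : R) : Omega x -> Omega y -> 0 <= t <= 1 ->
  Omega (x + t *: (y - x)).
Proof.
move=> Ox Oy /andP[t0 t1]; case: hO => _ _ _ cO.
have := cO y x (Itv01 t0 t1); rewrite !inE => /(_ Oy Ox).
suff -> : x + t *: (y - x) = t *: y + (1 - t) *: x by [].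
by rewrite scalerBl scale1r scalerBr addrCA addrA.
Qed.

Lemma frontier_notin x : frontier Omega x -> ~ Omega x.
Proof.
by move=> [_ nO] Ox; apply: nO; move/interior_id: domain_open => ->.
Qed.

Lemma closure_domain x : closure Omega x <-> Omega x \/ frontier Omega x.
Proof.
split=> [cx|[Ox|[]//]]; last exact: subset_closure.
have [Ox|nO] := pselect (Omega x); [by left|right].
by split=> // /interior_subset.
Qed.

Lemma domain_bounded : exists2 D : R, 1 <= D & forall x, Omega x -> enorm x <= D.
Proof.
case: hO => _ _ [M [_ hM]] _.
pose c := `|M| + 1.
have c0 : 0 < c by rewrite ltr_wpDl.
exists (n%:R * c + 1); first by rewrite lerDr mulr_ge0// ltW.
move=> x Ox; apply: (@le_trans _ _ (n%:R * c)); last by rewrite lerDl.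
apply: enorm_le_sum => [|i]; first exact: ltW.
have xc : `|x| <= c.
  by apply: hM => //; apply: le_lt_trans (ler_norm M) _; rewrite ltrDl.
apply: le_trans xc; rewrite [leRHS]/Num.Def.normr/= mx_normrE.
by apply/bigmax_geP; right => /=; exists (0, i).
Qed.

(** The exit parameter is the supremum of the parameters for which the point of
    the segment lies in Omega. *)
Lemma exit_point x z : Omega x -> ~ Omega z ->
  exists s : R, [/\ 0 < s <= 1, frontier Omega (x + s *: (z - x)) &
    forall r : R, 0 <= r < s -> Omega (x + r *: (z - x))].
Proof.
move=> Ox nOz; set v := z - x.
pose S := [set r : R | 0 <= r /\ Omega (x + r *: v)].
have S0 : S 0 by split => //; rewrite scale0r addr0.
have down (r r' : R) : S r -> 0 <= r' <= r -> S r'.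
  move=> [r0 Or] /andP[r'0 r'r]; split => //.
  have [re|rn] := eqVneq r 0.
    have -> : r' = 0 by lra.
    by rewrite scale0r addr0.
  have rp : 0 < r by rewrite lt_neqAle eq_sym rn.
  have := @domain_conv x (x + r *: v) (r' / r) Ox Or.
  rewrite divr_ge0//= ler_pdivrMr// mul1r r'r => /(_ isT).
  by rewrite [x + _ - x]addrC addKr scalerA divfK.
have S1 (r : R) : S r -> r < 1.
  move=> Sr; rewrite ltNge; apply/negP => r1; apply: nOz.
  have r01 : 0 <= (1 : R) <= r by rewrite ler01.
  have [_] := down r 1 Sr r01.
  by rewrite scale1r /v addrC subrK.
have hS : has_sup S by split; [exists 0|exists 1 => r /S1/ltW].
have s0 : 0 <= sup S by apply: ub_le_sup S0; exists 1 => r /S1/ltW.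
have open_r (r : R) : Omega (x + r *: v) ->
    exists2 e : R, 0 < e & forall r' : R, `|r' - r| < e -> Omega (x + r' *: v).
  move=> Or; have [e e0 eO] := open_enorm domain_open Or.
  have v0 : 0 < enorm v + 1 by rewrite ltr_wpDl ?enorm_ge0.
  exists (e / (enorm v + 1)); first by rewrite divr_gt0.
  move=> r'; rewrite ltr_pdivlMr// => r're; apply: eO.
  have -> : x + r *: v - (x + r' *: v) = (r - r') *: v.
    by rewrite opprD addrACA subrr add0r scalerBl.
  rewrite enormZ distrC; apply: le_lt_trans r're.
  by rewrite ler_wpM2l// lerDl.
have below (r : R) : 0 <= r < sup S -> S r.
  move=> /andP[r0 rs].
  have rs' : 0 < sup S - r by rewrite subr_gt0.
  have [r' Sr' rr'] := sup_adherent rs' hS.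
  by apply: (down _ _ Sr'); rewrite r0/=; lra.
exists (sup S); split.
- apply/andP; split; last first.
    by apply: ge_sup; [exists 0|move=> r /S1/ltW].
  have [e e0 eO] := open_r 0 S0.2.
  apply: (@lt_le_trans _ _ (e / 2)); first by rewrite divr_gt0.
  apply: ub_le_sup; first by exists 1 => r /S1/ltW.
  split; first by rewrite ltW// divr_gt0.
  by apply: eO; rewrite subr0 gtr0_norm ?divr_gt0//; lra.
- have nO : ~ Omega (x + sup S *: v).
    move=> Os; have [e e0 eO] := open_r _ Os.
    have : sup S + e / 2 <= sup S.
      apply: ub_le_sup; first by exists 1 => r /S1/ltW.
      split; last first.
        by apply: eO; rewrite addrC addKr gtr0_norm ?divr_gt0//; lra.
      by lra.
    by lra.
  split; last by move=> /interior_subset.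
  apply: closure_enorm => e e0.
  have v0 : 0 < enorm v + 1 by rewrite ltr_wpDl ?enorm_ge0.
  have ev0 : 0 < e / (enorm v + 1) by rewrite divr_gt0.
  have [r Sr rs] := sup_adherent ev0 hS.
  exists (x + r *: v); first by case: Sr.
  have -> : x + sup S *: v - (x + r *: v) = (sup S - r) *: v.
    by rewrite opprD addrACA subrr add0r scalerBl.
  have rS : r <= sup S by apply: ub_le_sup => //; exists 1 => t /S1/ltW.
  rewrite enormZ ger0_norm ?subr_ge0//.
  apply: (@le_lt_trans _ _ ((sup S - r) * (enorm v + 1))).
    by rewrite ler_wpM2l ?subr_ge0// lerDl.
  by rewrite -ltr_pdivlMr//; lra.
- by move=> r /below[].
Qed.

Lemma ray_exit x (e : 'rV[R]_n) : Omega x -> e != 0 ->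
  exists s : R, [/\ 0 < s, frontier Omega (x + s *: e) &
    forall r : R, 0 <= r < s -> Omega (x + r *: e)].
Proof.
move=> Ox e0; have [D D1 hD] := domain_bounded.
have ee : 0 < enorm e by rewrite lt_neqAle eq_sym enorm_eq0 e0 enorm_ge0.
pose T := (2 * D + 1) / enorm e.
have T0 : 0 < T by rewrite divr_gt0//; lra.
have nO : ~ Omega (x + T *: e).
  move=> /hD; have := ler_enormD (x + T *: e) (- x).
  rewrite addrC addKr enormN enormZ gtr0_norm// divfK ?gt_eqF//.
  by have := hD _ Ox; lra.
have [s [/andP[s0 s1] fs Os]] := exit_point Ox nO.
have E r : x + r *: (x + T *: e - x) = x + (r * T) *: e.
  by rewrite [x + _ - x]addrC addKr scalerA.
exists (s * T); split; first by rewrite mulr_gt0.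
  by rewrite -E.
move=> r /andP[r0 rs]; have := Os (r / T).
rewrite E divfK ?gt_eqF//; apply.
by rewrite divr_ge0 ?(ltW T0)//= ltr_pdivrMr.
Qed.

Lemma frontier_nonempty : frontier Omega !=set0.
Proof.
case: hO => _ [x Ox] _ _.
pose e : 'rV[R]_n := const_mx 1.
have e0 : e != 0.
  apply/eqP => /matrixP/(_ 0 (Ordinal hn)); rewrite !mxE => /eqP.
  by rewrite oner_eq0.
by have [s [_ fs _]] := ray_exit Ox e0; exists (x + s *: e).
Qed.

Lemma dist_le x y : frontier Omega y -> d x <= enorm (x - y).
Proof.
move=> fy; apply: ge_inf; last by exists y.
by exists 0 => _ [z _ <-]; exact: enorm_ge0.
Qed.

Lemma le_dist x (c : R) :
  (forall y, frontier Omega y -> c <= enorm (x - y)) -> c <= d x.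
Proof.
move=> H; apply: lb_le_inf; last by move=> _ [y fy <-]; exact: H.
by have [y fy] := frontier_nonempty; exists (enorm (x - y)); exists y.
Qed.

Lemma dist_ge0 x : 0 <= d x.
Proof. by apply: le_dist => y _; exact: enorm_ge0. Qed.

Lemma dist_frontier0 x : frontier Omega x -> d x = 0.
Proof.
move=> fx; apply/eqP; rewrite eq_le dist_ge0 andbT.
by have := dist_le x fx; rewrite subrr enorm0.
Qed.

Lemma dist_lip x y : d x <= d y + enorm (x - y).
Proof.
rewrite -lerBlDr; apply: le_dist => z fz; rewrite lerBlDr.
apply: le_trans (dist_le x fz) _; rewrite [leRHS]addrC.
exact: ler_enorm_dist.
Qed.

Lemma dist_gt0 x : Omega x -> 0 < d x.
Proof.
move=> Ox; have [e e0 eO] := open_enorm domain_open Ox.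
apply: lt_le_trans e0 _; apply: le_dist => y fy.
by rewrite leNgt; apply/negP => /eO; exact: frontier_notin.
Qed.

Lemma dist_ball x z : Omega x -> enorm (z - x) < d x -> Omega z.
Proof.
move=> Ox zx; apply: contrapT => nOz.
have [s [/andP[s0 s1] fs _]] := exit_point Ox nOz.
have := dist_le x fs; rewrite opprD addrA subrr add0r enormN enormZ gtr0_norm//.
rewrite leNgt => /negP; apply; apply: le_lt_trans zx.
by rewrite ler_piMl ?enorm_ge0.
Qed.

Lemma closure_bounded : exists2 D : R, 1 <= D &
  forall x, closure Omega x -> enorm x <= D.
Proof.
have [D D1 hD] := domain_bounded; exists (D + 1); first by lra.
move=> x cx.
have [|y [Oy /= yx]] := cx [set y : 'rV[R]_n | enorm (y - x) < 1].
  apply: open_nbhs_nbhs; split; first exact: open_enorm_lt.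
  by rewrite /= subrr enorm0.
have := ler_enormD y (x - y); rewrite addrC subrK enorm_sub.
by have := hD _ Oy; lra.
Qed.

Lemma frontier_compact : compact (frontier Omega).
Proof.
have [D D1 hD] := closure_bounded.
apply: bounded_closed_compact.
  exists D; split; first exact: num_real.
  move=> M DM x [cx _]; apply: le_trans (normr_le_enorm x) _.
  by apply: le_trans (hD _ cx) _; exact: ltW.
rewrite /frontier setDE; apply: closedI; first exact: closed_closure.
apply: open_closedC; exact: open_interior.
Qed.

Lemma closure_compact : compact (closure Omega).
Proof.
have [D D1 hD] := closure_bounded.
apply: bounded_closed_compact; last exact: closed_closure.
exists D; split; first exact: num_real.
move=> M DM x cx; apply: le_trans (normr_le_enorm x) _.
by apply: le_trans (hD _ cx) _; exact: ltW.
Qed.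

Lemma dist_attained x : exists2 y, frontier Omega y & d x = enorm (x - y).
Proof.
have cf : {within frontier Omega, continuous (fun y => enorm (x - y))}.
  apply: continuous_subspaceT => y.
  apply: (@continuous_comp _ _ _ (fun y => x - y) (@enorm R n)).
    by apply: continuousB; [exact: cst_continuous|exact: cvg_id].
  exact: enorm_continuous.
have [y] := EVT_min_rV frontier_nonempty frontier_compact cf.
rewrite inE => fy hy; exists y => //; apply/eqP; rewrite eq_le dist_le//=.
by apply: le_dist => z fz; apply: hy; rewrite inE.
Qed.

Lemma dist_bounded : exists2 D : R, 1 <= D &
  forall x, Omega x -> enorm x <= D /\ d x <= D.
Proof.
have [D D1 hD] := closure_bounded; exists (2 * D); first by lra.
have [y fy] := frontier_nonempty.
move=> x Ox; have xD := hD _ (subset_closure Ox).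
split; first by lra.
apply: le_trans (dist_le x fy) _; apply: le_trans (ler_enormD _ _) _.
by rewrite enormN; have := hD _ fy.1; lra.
Qed.

(** The vector nu points to x0 from a nearest frontier point y. A point of
    Omega strictly behind the hyperplane through y orthogonal to nu would, with
    a point of the ball of centre x0 and radius d x0, put y inside a segment of
    Omega. So Omega lies on one side, and leaving it along -nu from x crosses
    the frontier at distance at most nu.(x - y). *)
Lemma dist_support x0 : Omega x0 -> exists2 nu : 'rV[R]_n, enorm nu = 1 &
  forall x, Omega x -> d x <= d x0 + dotp nu (x - x0).
Proof.
move=> O0; have [y fy dy] := dist_attained x0.
have d0 := dist_gt0 O0.
have dne : d x0 != 0 by rewrite gt_eqF.
pose nu := (d x0)^-1 *: (x0 - y).
have enu : enorm nu = 1.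
  by rewrite enormZ gtr0_norm ?invr_gt0// -dy mulVf.
have nu1 : dotp nu nu = 1 by rewrite -sqr_enorm enu expr1n.
have yE : y = x0 - d x0 *: nu.
  by rewrite scalerA divff// scale1r opprB addrC subrK.
clearbody nu; exists nu => //.
have side x : Omega x -> 0 <= dotp nu (x - y).
  move=> Ox; rewrite leNgt; apply/negP => neg.
  set w := x - y in neg; have xE : x = y + w by rewrite addrC subrK.
  clearbody w; subst x.
  (* A step t against w enters the open ball of radius d x0 about x0. *)
  pose t := - dotp nu w * d x0 / (enorm w ^+ 2 + 1).
  have w0 : 0 < enorm w ^+ 2 + 1 by rewrite ltr_wpDl ?sqr_ge0.
  have t0 : 0 < t by rewrite divr_gt0// mulr_gt0// oppr_gt0.
  have Oz : Omega (y - t *: w).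
    apply: (dist_ball O0); rewrite yE.
    have -> : x0 - d x0 *: nu - t *: w - x0 = - (d x0 *: nu + t *: w).
      by apply/rowP => i; rewrite !mxE; ring.
    rewrite enormN -(ltr_pXn2r (n := 2)) ?nnegrE ?enorm_ge0 ?ltW//.
    rewrite sqr_enorm !dotpE nu1 (dotpC w) -sqr_enorm.
    have tE : t * (enorm w ^+ 2 + 1) = - dotp nu w * d x0.
      by rewrite /t divfK// gt_eqF.
    by clearbody t; nra.
  apply: (frontier_notin fy).
  have t01 : 0 <= t / (1 + t) <= 1.
    apply/andP; split; first by apply: divr_ge0; lra.
    by rewrite ler_pdivrMr; lra.
  have := domain_conv Oz Ox t01.
  have -> : y + w - (y - t *: w) = (1 + t) *: w.
    by apply/rowP => i; rewrite !mxE; ring.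
  rewrite scalerA divfK ?subrK//.
  by rewrite gt_eqF//; lra.
move=> x Ox.
have -> : d x0 + dotp nu (x - x0) = dotp nu (x - y).
  by rewrite yE !dotpE nu1; lra.
apply/ler_addgt0Pr => e e0.
pose s := dotp nu (x - y) + e.
have nOx' : ~ Omega (x - s *: nu).
  by move=> /side; rewrite addrAC !dotpE nu1 /s !dotpE; lra.
have [r [/andP[r0 r1] fr _]] := exit_point Ox nOx'.
have s0 : 0 < s by rewrite /s ltr_wpDl// side.
apply: le_trans (dist_le x fr) _.
have -> : x - (x + r *: (x - s *: nu - x)) = (r * s) *: nu.
  by apply/rowP => i; rewrite !mxE; ring.
rewrite enormZ enu mulr1 gtr0_norm ?mulr_gt0//.
by rewrite ler_piMl// ltW.
Qed.

Lemma dist_continuous : continuous d.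
Proof.
move=> x; have FF : Filter (nbhs x) by exact: nbhs_filter.
apply/(@cvgrPdist_lt _ _ _ (nbhs x) FF) => e e0; near=> y.
have yx : enorm (y - x) < e.
  near: y; apply: open_nbhs_nbhs; split; first exact: open_enorm_lt.
  by rewrite /= subrr enorm0.
have h1 := dist_lip x y; have h2 := dist_lip y x.
rewrite ltr_norml; apply/andP; rewrite enorm_sub in h1; split; lra.
Unshelve. all: by end_near.
Qed.

End convex_domain.

(** * Convex solutions and the mass forced by a contact point *)

Section slab_ball.
Variables (R : realType) (n : nat) (nu : 'rV[R]_n).
Hypothesis hnu : enorm nu = 1.

(** Translating and dilating a slab ball gives a slab ball, and translates along
    nu by at least the thickness of the slab are disjoint. *)
Definition slab_ball (c : 'rV[R]_n) (a b : R) : set 'rV[R]_n :=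
  [set y | enorm (y - c) < a] `&` [set y | `|dotp nu (y - c)| < b].

Lemma slab_ball_open c a b : open (slab_ball c a b).
Proof. by apply: openI; [exact: open_enorm_lt|exact: open_dotp_lt]. Qed.

Lemma slab_ball_measure c a b (s : R) : 0 < s ->
  lebesgue_outer (slab_ball c (s * a) (s * b)) =
  ((s ^+ n)%:E * lebesgue_outer (slab_ball 0 a b))%E.
Proof.
move=> s0; rewrite -(lebesgue_outer_affine c)//; congr lebesgue_outer.
apply/seteqP; split => [y [/= y1 y2]|_ [y [/= y1 y2] <-]].
  exists (s^-1 *: (y - c)); last first.
    by rewrite scalerA divff ?gt_eqF// scale1r addrC subrK.
  split; rewrite /= subr0.
    by rewrite enormZ gtr0_norm ?invr_gt0// ltr_pdivrMl.
  by rewrite dotpZr normrM gtr0_norm ?invr_gt0// ltr_pdivrMl.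
rewrite !subr0 in y1 y2.
split; rewrite /= [c + _]addrC addrK.
  by rewrite enormZ gtr0_norm// ltr_pM2l.
by rewrite dotpZr normrM gtr0_norm// ltr_pM2l.
Qed.

Lemma slab_ball_gt0 c a b : 0 < a -> 0 < b ->
  (0 < lebesgue_outer (slab_ball c a b))%E.
Proof.
move=> a0 b0; pose e := Num.min a b / (n%:R + 1).
have n0 : 0 <= n%:R :> R by [].
have m0 : 0 < Num.min a b by rewrite lt_min a0.
have e0 : 0 < e by rewrite /e divr_gt0//; lra.
have ne : n%:R * e < Num.min a b.
  by rewrite /e mulrCA gtr_pMr// ltr_pdivrMr; lra.
apply: (@lebesgue_outer_cube_gt0 _ _ c e) => // y yc.
have ye : enorm (y - c) <= n%:R * e.
  apply: enorm_le_sum => [|i]; first exact: ltW.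
  by have /andP[h1 h2] := yc i; rewrite !mxE gtr0_norm; lra.
have := le_lt_trans ye ne; rewrite lt_min => /andP[ya yb].
split => //=; apply: le_lt_trans (normr_dotp_le _ _) _.
by rewrite hnu mul1r.
Qed.

Lemma slab_ball_lty c a b : 0 <= a ->
  (lebesgue_outer (slab_ball c a b) < +oo)%E.
Proof.
move=> a0.
apply: (@le_lt_trans _ _ (lebesgue_outer [set (c + 1 *: y)%R | y in slab_ball 0 a b])).
  apply: le_lebesgue_outer => y [y1 y2]; exists (y - c).
    by split; rewrite /= subr0.
  by rewrite scale1r addrC subrK.
rewrite lebesgue_outer_affine// expr1n mul1e.
apply: le_lt_trans (@lebesgue_outer_bounded _ _ _ a a0 _) _; last exact: ltry.
move=> y [/= ya _] i; apply: le_lt_trans (normr_coord_le _ _) _.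
by rewrite -[y]subr0.
Qed.

End slab_ball.

Section solution.
Variables (R : realType) (n : nat) (Omega : set 'rV[R]_n).
Variables (alpha p M : R) (u : 'rV[R]_n -> R).
Hypothesis hn : (0 < n)%N.
Hypothesis hO : bounded_convex_domain Omega.
Hypothesis hM : 0 < M.
Hypothesis hu : convex_solution Omega alpha p M u.
Implicit Types x y z : 'rV[R]_n.
Local Notation d := (dist_frontier Omega).

Lemma solution_conv x y (t : R) : Omega x -> Omega y -> 0 <= t <= 1 ->
  u (x + t *: (y - x)) <= (1 - t) * u x + t * u y.
Proof.
move=> Ox Oy /andP[t0 t1]; case: hu => _ cu _ _.
have := cu (Itv01 t0 t1) y x; rewrite !inE => /(_ Oy Ox).
have -> : x + t *: (y - x) = t *: y + (1 - t) *: x.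
  by rewrite scalerBl scale1r scalerBr addrCA addrA.
by rewrite [_ * u x + _]addrC.
Qed.

Lemma solution_continuous_enorm y (e : R) : closure Omega y -> 0 < e ->
  exists2 r : R, 0 < r & forall x, closure Omega x -> enorm (x - y) < r ->
    `|u x - u y| < e.
Proof.
move=> cy e0; case: hu => cu _ _ _.
have /subspace_continuousP/(_ _ cy) := cu.
move=> /cvgrPdist_lt/(_ _ e0); rewrite near_withinE.
rewrite -nbhs_nearE nbhsE => -[V [oV Vy] VB].
have [r r0 rV] := open_enorm oV Vy.
exists r => // x cx xy; rewrite distrC; apply: VB => //; apply: rV.
by rewrite enorm_sub.
Qed.

Lemma solution_min : exists2 x0, closure Omega x0 &
  forall x, closure Omega x -> u x0 <= u x.
Proof.
have c0 : closure Omega !=set0.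
  by have [y [cy _]] := frontier_nonempty hn hO; exists y.
case: hu => cu _ _ _.
have [x0] := EVT_min_rV c0 (closure_compact hO) cu.
rewrite inE => cx0 h; exists x0 => // x cx; apply: h.
by rewrite inE.
Qed.

Lemma solution_max : exists2 x0, closure Omega x0 &
  forall x, closure Omega x -> u x <= u x0.
Proof.
have c0 : closure Omega !=set0.
  by have [y [cy _]] := frontier_nonempty hn hO; exists y.
case: hu => cu _ _ _.
have [x0] := EVT_max_rV c0 (closure_compact hO) cu.
rewrite inE => cx0 h; exists x0 => // x cx; apply: h.
by rewrite inE.
Qed.

(** At a positive maximum x0, convexity on a line through x0 shows that u is at
    least u x0 at all points between x0 and the frontier, against the zero
    boundary values. *)
Lemma solution_le0 x : closure Omega x -> u x <= 0.
Proof.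
move=> cx; have [x0 cx0 umax] := solution_max.
apply: le_trans (umax _ cx) _; rewrite leNgt; apply/negP => u0.
have O0 : Omega x0.
  have /closure_domain[//|fx] := cx0.
  by case: hu => _ _ _ /(_ _ fx) ux; rewrite ux ltxx in u0.
pose e : 'rV[R]_n := const_mx 1.
have e0 : e != 0.
  apply/eqP => /matrixP/(_ 0 (Ordinal hn)); rewrite !mxE => /eqP.
  by rewrite oner_eq0.
have [s [s0 fs Os]] := ray_exit hO O0 e0.
have ee : 0 < enorm e by rewrite lt_neqAle eq_sym enorm_eq0 e0 enorm_ge0.
have d0 := dist_gt0 hn hO O0.
pose r0 := d x0 / (2 * enorm e).
have r00 : 0 < r0 by rewrite divr_gt0// mulr_gt0.
have Oz : Omega (x0 - r0 *: e).
  apply: (dist_ball hO O0); rewrite [x0 - _]addrC addrK enormN enormZ gtr0_norm//.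
  by rewrite /r0 invfM mulrA mulfVK ?gt_eqF//; lra.
have ule (r : R) : 0 <= r < s -> u x0 <= u (x0 + r *: e).
  move=> rs; have Or := Os r rs; case/andP: rs => r_ge0 rs.
  have rr : 0 < r0 + r by lra.
  have t01 : 0 <= r0 / (r0 + r) <= 1.
    by rewrite divr_ge0 ?(ltW r00) ?(ltW rr)//= ler_pdivrMr// mul1r lerDl.
  have := solution_conv Oz Or t01.
  have -> : x0 - r0 *: e + r0 / (r0 + r) *: (x0 + r *: e - (x0 - r0 *: e)) = x0.
    have -> : x0 + r *: e - (x0 - r0 *: e) = (r0 + r) *: e.
      by apply/rowP => i; rewrite !mxE; ring.
    by rewrite scalerA divfK ?subrK// gt_eqF.
  have uz := umax _ (subset_closure Oz).
  set t := r0 / (r0 + r) in t01 *; have t0 : 0 < t by rewrite divr_gt0.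
  by case/andP: t01 => _ t1; nra.
have [r rp ru] := solution_continuous_enorm fs.1 u0.
pose q := Num.max (s / 2) (s - r / (2 * enorm e)).
have re0 : 0 < r / (2 * enorm e) by rewrite divr_gt0// mulr_gt0.
have qs : 0 <= q < s.
  by rewrite le_max gt_max divr_ge0 ?(ltW s0)//=; apply/andP; split; lra.
have := ru _ (subset_closure (Os q qs)).
have -> : x0 + q *: e - (x0 + s *: e) = - ((s - q) *: e).
  by apply/rowP => i; rewrite !mxE; ring.
case: hu => _ _ _ /(_ _ fs) ->.
rewrite enormN enormZ subr0 ger0_norm; last by case/andP: qs; lra.
have qr : (s - q) * enorm e < r.
  rewrite -ltr_pdivlMr//.
  have : s - r / (2 * enorm e) <= q by rewrite le_max lexx orbT.
  have -> : r / (2 * enorm e) = r / enorm e / 2 by rewrite invfM mulrA mulrAC.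
  have re1 : 0 < r / enorm e by rewrite divr_gt0.
  by lra.
move=> /(_ qr); have := ule q qs => h1.
rewrite gtr0_norm; last by exact: lt_le_trans h1.
by rewrite ltNge h1.
Qed.

(** Convexity compares u at y with u at a nearby point of the segment from x
    to y. *)
Lemma local_subdifferential x (q : 'rV[R]_n) (r : R) : Omega x -> 0 < r ->
  (forall y, Omega y -> enorm (y - x) < r -> u x + dotp q (y - x) <= u y) ->
  subdifferential Omega u x q.
Proof.
move=> Ox r0 H y Oy.
pose t := r / (r + enorm (y - x)).
have e0 := enorm_ge0 (y - x).
have rr : 0 < r + enorm (y - x) by lra.
have t0 : 0 < t by rewrite divr_gt0.
have t1 : t <= 1 by rewrite ler_pdivrMr// mul1r lerDl.
have t01 : 0 <= t <= 1 by rewrite (ltW t0).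
have Oz := domain_conv hO Ox Oy t01.
have zx : x + t *: (y - x) - x = t *: (y - x) by rewrite addrC addKr.
have zr : enorm (x + t *: (y - x) - x) < r.
  rewrite zx enormZ gtr0_norm// /t mulrAC ltr_pdivrMr// ltr_pM2l//.
  by rewrite ltrDr.
have := H _ Oz zr; rewrite zx dotpZr.
have := solution_conv Ox Oy t01.
move: (u (x + _)) => w h1 h2.
rewrite -(ler_pM2l t0); lra.
Qed.

Definition ma_density x : R := M * `|u x| `^ p * d x `^ (- alpha).

Lemma ma_density_ge0 x : 0 <= ma_density x.
Proof. by rewrite !mulr_ge0 ?powR_ge0// ltW. Qed.

Lemma open_borel (E : set 'rV[R]_n) : open E -> borel E.
Proof. by move=> oE; apply: sub_gen_smallest. Qed.

Lemma monge_ampere_le (E : set 'rV[R]_n) (Lam : R) : open E -> E `<=` Omega ->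
  (forall x, E x -> ma_density x <= Lam) ->
  (monge_ampere Omega u E <= Lam%:E * lebesgue_outer E)%E.
Proof.
move=> oE EO El; case: hu => _ _ mu _; rewrite mu//; last exact: open_borel.
rewrite -(integral_cst (@leb R n) (open_lebesgue_measurable oE)).
by apply: ge0_le_integral_any => x Ex; rewrite lee_fin ?ma_density_ge0// El.
Qed.

Lemma monge_ampere_ge (E : set 'rV[R]_n) (lam : R) : open E -> E `<=` Omega ->
  0 <= lam -> (forall x, E x -> lam <= ma_density x) ->
  (lam%:E * lebesgue_outer E <= monge_ampere Omega u E)%E.
Proof.
move=> oE EO lam0 El; case: hu => _ _ mu _; rewrite mu//; last exact: open_borel.
rewrite -(integral_cst (@leb R n) (open_lebesgue_measurable oE)).
by apply: ge0_le_integral_any => x Ex; rewrite lee_fin//; exact: El.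
Qed.

(** On the closed slab ball the function u - (L + q).h has a minimum. It is not
    attained on the boundary, because there the quadratic term is at least
    B r^2 and exceeds q.h; so L + q is a subgradient at an interior point. *)
Lemma slab_slope_subdifferential x0 (L nu q : 'rV[R]_n) (B rho r : R) :
  Omega x0 -> enorm nu = 1 -> 0 < B -> 0 < rho <= 1 -> 0 < r < d x0 ->
  (forall x, enorm (x - x0) <= r -> u x0 + dotp L (x - x0) +
     B * (enorm (x - x0) ^+ 2 + (dotp nu (x - x0) / rho) ^+ 2) <= u x) ->
  (forall h : 'rV[R]_n, enorm h <= r -> `|dotp nu h| <= r * rho ->
     `|dotp q h| < B * r ^+ 2) ->
  exists2 x, slab_ball nu x0 r (r * rho) x & subdifferential Omega u x (L + q).
Proof.
move=> O0 enu B0 /andP[rho0 rho1] /andP[r0 rd] ul qh.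
pose F := [set x | enorm (x - x0) <= r] `&`
  [set x | `|dotp nu (x - x0)| <= r * rho].
have cF : closed F.
  apply: closedI.
    apply: (@closed_comp _ _ (fun y => enorm (y - x0)) [set t | t <= r]).
      move=> y _; apply: (@continuous_comp _ _ _ (fun y => y - x0) (@enorm R n)).
        by apply: continuousB; [exact: cvg_id|exact: cst_continuous].
      exact: enorm_continuous.
    exact: closed_le.
  apply: (@closed_comp _ _ (fun y => `|dotp nu (y - x0)|) [set t | t <= r * rho]).
    move=> y _; apply: (@continuous_comp _ _ _ (fun y => dotp nu (y - x0))
      (Num.Def.normr : R -> R)); last exact: norm_continuous.
    apply: (@continuous_comp _ _ _ (fun y => y - x0) (dotp nu)).
      by apply: continuousB; [exact: cvg_id|exact: cst_continuous].
    exact: dotp_continuous.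
  exact: closed_le.
have FO : F `<=` Omega.
  by move=> x [/= xr _]; apply: (dist_ball hO O0); exact: le_lt_trans rd.
have bF : compact F.
  apply: bounded_closed_compact => //; exists (enorm x0 + r).
  split; first exact: num_real.
  move=> K hK x [/= xr _]; apply: le_trans (ltW hK).
  apply: le_trans (normr_le_enorm x) _.
  by have := ler_enormD x0 (x - x0); rewrite addrC subrK; lra.
have F0 : F x0.
  by split; rewrite /= subrr ?enorm0 ?(ltW r0)// dotpC dotp0l normr0 mulr_ge0// ltW.
pose phi x := u x - dotp (L + q) (x - x0).
have cphi : {within F, continuous phi}.
  have cuF : {within F, continuous u}.
    case: hu => cu _ _ _; apply: continuous_subspaceW cu.
    by move=> x /FO; exact: subset_closure.
  apply: (@within_continuousB _ _ _ _ u (fun y => dotp (L + q) (y - x0)) cuF).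
  apply: continuous_subspaceT => y.
  apply: (@continuous_comp _ _ _ (fun y => y - x0) (dotp (L + q))).
    by apply: continuousB; [exact: cvg_id|exact: cst_continuous].
  exact: dotp_continuous.
have [x] := EVT_min_rV (ex_intro _ x0 F0) bF cphi.
rewrite inE => Fx xmin.
have phi0 : phi x <= u x0.
  have := xmin x0; rewrite inE => /(_ F0).
  by rewrite {2}/phi subrr dotpC dotp0l subr0.
have [x1 x2] := Fx.
have xE : slab_ball nu x0 r (r * rho) x.
  have key : B * (enorm (x - x0) ^+ 2 + (dotp nu (x - x0) / rho) ^+ 2) < B * r ^+ 2.
    have := ul x x1; have := qh _ x1 x2; move: phi0.
    rewrite /phi dotpDl ltr_norml => h1 /andP[_ h2] h3; lra.
  rewrite ltr_pM2l// in key.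
  split => /=; rewrite ltNge; apply/negP => h.
    have : r ^+ 2 <= enorm (x - x0) ^+ 2 
      by rewrite lerXn2r ?nnegrE ?enorm_ge0 ?(ltW r0).
    by have := sqr_ge0 (dotp nu (x - x0) / rho); lra.
  have : r ^+ 2 <= (dotp nu (x - x0) / rho) ^+ 2.
    rewrite -[leRHS]real_normK ?num_real// ler_sqr ?nnegrE ?(ltW r0)//.
    by rewrite normrM normfV (gtr0_norm rho0) ler_pdivlMr.
  by have := sqr_ge0 (enorm (x - x0)); lra.
exists x => //.
have [e e0 eE] := open_enorm (@slab_ball_open _ _ nu x0 r (r * rho)) xE.
apply: (local_subdifferential (FO _ Fx) e0) => y Oy yx.
have Fy : F y.
  have [/= h1 h2] : slab_ball nu x0 r (r * rho) y by apply: eE; rewrite enorm_sub.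
  by split; apply: ltW.
have := xmin y; rewrite inE => /(_ Fy); rewrite /phi.
have -> : y - x0 = (y - x) + (x - x0) by rewrite subrKA.
by rewrite [dotp _ (y - x + _)]dotpDr; lra.
Qed.

(** The set of slopes of u over the slab ball E contains N >= 1 / (4 rho^2)
    disjoint translates of (B / 2) E, so its measure is at least
    N (B / 2)^n |E|, while the equation bounds it by Lam |E|. *)
Lemma quadratic_touching_bound x0 (L nu : 'rV[R]_n) (B rho r Lam : R) :
  Omega x0 -> enorm nu = 1 -> 0 < B -> 0 < rho <= 1 -> 0 < r < d x0 ->
  (forall x, enorm (x - x0) <= r -> u x0 + dotp L (x - x0) +
     B * (enorm (x - x0) ^+ 2 + (dotp nu (x - x0) / rho) ^+ 2) <= u x) ->
  (forall x, enorm (x - x0) <= r -> ma_density x <= Lam) ->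
  B ^+ n <= 2 ^+ n.+2 * rho ^+ 2 * Lam.
Proof.
move=> O0 enu B0 rho01 r01 ul ulam.
have /andP[rho0 rho1] := rho01; have /andP[r0 rd] := r01.
pose E := slab_ball nu x0 r (r * rho).
have EO : E `<=` Omega.
  by move=> x [/= xr _]; apply: (dist_ball hO O0); exact: lt_trans rd.
(* The k-th slope set is shifted along nu by k times its own thickness; for
   k < N the shift is at most half of the admissible size B r / (2 rho). *)
pose v k := L + (k%:R * (B * r * rho)) *: nu.
pose A k := slab_ball nu (v k) (B / 2 * r) (B / 2 * (r * rho)).
pose N := (Num.truncn (1 / (4 * rho ^+ 2))).+1.
have nu1 : dotp nu nu = 1 by rewrite -sqr_enorm enu expr1n.
have Brr : 0 < B * r * rho by rewrite !mulr_gt0.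
have AP k : (k < N)%N -> A k `<=` \bigcup_(x in E) subdifferential Omega u x.
  move=> kN q [/= q1 q2].
  set b := q - v k in q1 q2.
  have -> : q = L + (q - L) by rewrite addrC subrK.
  apply: (slab_slope_subdifferential O0 enu B0 rho01 r01 ul) => h hr hrho.
  have -> : q - L = b + (k%:R * (B * r * rho)) *: nu.
    by rewrite /b /v opprD addrA subrK.
  rewrite dotpDl dotpZl.
  have k4 : k%:R * rho ^+ 2 <= 4^-1.
    have h4 : k%:R <= 1 / (4 * rho ^+ 2).
      apply: le_trans (_ : (Num.truncn (1 / (4 * rho ^+ 2)))%:R <= _).
        by rewrite ler_nat -ltnS.
      by rewrite truncn_le// divr_ge0// mulr_ge0// sqr_ge0.
    rewrite -ler_pdivlMr ?exprn_gt0//.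
    by rewrite mul1r invfM in h4.
  apply: le_lt_trans (ler_normD _ _) _.
  have h1 : `|dotp b h| < B / 2 * r * r.
    apply: le_lt_trans (normr_dotp_le _ _) _.
    apply: (@le_lt_trans _ _ (enorm b * r)).
      by rewrite ler_wpM2l ?enorm_ge0.
    by rewrite ltr_pM2r.
  have h2 : `|k%:R * (B * r * rho) * dotp nu h| <= B * r * r / 4.
    have kB : 0 <= k%:R * (B * r * rho) by rewrite mulr_ge0// ltW.
    rewrite normrM (ger0_norm kB).
    apply: (@le_trans _ _ (k%:R * (B * r * rho) * (r * rho))).
      by rewrite ler_wpM2l.
    have Br0 : 0 <= B * r * r by rewrite ltW// !mulr_gt0.
    have -> : k%:R * (B * r * rho) * (r * rho) = B * r * r * (k%:R * rho ^+ 2).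
      by ring.
    by rewrite ler_wpM2l.
  have Br2 : 0 < B * r * r by rewrite !mulr_gt0.
  by rewrite expr2; lra.
have vE k q : dotp nu (q - v k) = dotp nu (q - L) - k%:R * (B * r * rho).
  rewrite (_ : q - v k = (q - L) - (k%:R * (B * r * rho)) *: nu).
    by rewrite dotpDr dotpNr dotpZr nu1 mulr1.
  by rewrite /v opprD addrA.
have tA : trivIset setT A.
  apply/trivIsetP => i j _ _ ij; rewrite -subset0.
  move=> q [[_ /= q1] [_ /= q2]]; move: q1 q2; rewrite !vE.
  set w := dotp nu (q - L); set c := B * r * rho.
  have cE : B / 2 * (r * rho) = c / 2 by rewrite /c; field.
  rewrite cE !ltr_norml => /andP[a1 a2] /andP[b1 b2].
  have c0 : 0 < c by [].
  wlog ltij : i j ij a1 a2 b1 b2 / (i < j)%N.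
    move=> W; case: (ltngtP i j) ij => // ltij _.
      by apply: (W i j) => //; rewrite ltn_eqF.
    by apply: (W j i) => //; rewrite ltn_eqF.
  have : (i.+1%:R : R) * c <= j%:R * c by rewrite ler_pM2r// ler_nat.
  rewrite -natr1 mulrDl mul1r.
  by clearbody w c; move: (i%:R * c) (j%:R * c) a1 a2 b1 b2 => *; lra.
have B20 : 0 < B / 2 by rewrite divr_gt0.
have mA k : (((B / 2) ^+ n)%:E * lebesgue_outer (slab_ball nu 0 r (r * rho))
    <= lebesgue_outer (A k))%E by rewrite slab_ball_measure.
have := lebesgue_outer_disjoint (fun k => @slab_ball_open _ _ nu (v k) _ _) tA AP mA.
move=> /le_trans/(_ (monge_ampere_le (@slab_ball_open _ _ nu _ _ _) EO _)).
have El x : E x -> ma_density x <= Lam by move=> [/= /ltW/ulam].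
move=> /(_ _ El).
have -> : lebesgue_outer E = lebesgue_outer (slab_ball nu 0 r (r * rho)).
  have := slab_ball_measure nu x0 r (r * rho) (s := 1).
  by rewrite expr1n mul1e !mul1r; apply.
have m0 : (0 < lebesgue_outer (slab_ball nu 0 r (r * rho)))%E.
  by apply: slab_ball_gt0 => //; rewrite mulr_gt0.
have mfin : (lebesgue_outer (slab_ball nu 0 r (r * rho)) < +oo)%E.
  by apply: slab_ball_lty; exact: ltW.
move: (lebesgue_outer _) m0 mfin => [m| |]//; rewrite lte_fin => m0 _.
rewrite -!EFinM -EFin_natmul lee_fin => key0.
have key : N%:R * (B / 2) ^+ n <= Lam.
  by rewrite -(ler_pM2r m0) -mulrA mulr_natl.
have N4 : 1 / (4 * rho ^+ 2) <= N%:R by rewrite ltW// truncnS_gt.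
have rr0 : 0 < rho ^+ 2 by rewrite exprn_gt0.
have h1 : 1 / (4 * rho ^+ 2) * (B / 2) ^+ n <= Lam.
  apply: le_trans key; rewrite ler_wpM2r//.
  by rewrite exprn_ge0// ltW.
have -> : B ^+ n = 2 ^+ n.+2 * rho ^+ 2 * (1 / (4 * rho ^+ 2) * (B / 2) ^+ n).
  rewrite exprMn exprVn !exprS; field.
  by rewrite !gt_eqF// exprn_gt0.
by rewrite ler_pM2l// mulr_gt0// exprn_gt0.
Qed.

End solution.

(** * Second-order estimates for real powers *)

Section powR_calculus.
Variable R : realType.
Implicit Types a y : R.

(** The mean value theorem with base point 1, on both sides of 1 at once. *)
Lemma MVT_from1 (f df : R -> R) y : 0 < y ->
  (forall z : R, 0 < z -> is_derive z 1 f (df z)) ->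
  exists z : R, [/\ 0 < z, 0 <= (z - 1) * (y - 1), `|z - 1| <= `|y - 1| &
    f y - f 1 = df z * (y - 1)].
Proof.
move=> y0 fdf.
have cf (a b : R) : 0 < a -> {within `[a, b], continuous f}.
  move=> a0; apply: derivable_within_continuous => z.
  rewrite in_itv/= => /andP[az _].
  by have [] := fdf z (lt_le_trans a0 az).
have [y1|y1|->] := ltgtP y 1.
- have [||z] := @MVT _ f df y 1 y1.
  + by move=> z; rewrite in_itv/= => /andP[yz _]; apply: fdf; exact: lt_trans yz.
  + exact: cf.
  rewrite in_itv/= => /andP[yz z1] E; exists z; split.
  + exact: lt_trans yz.
  + by rewrite -mulrNN mulr_ge0//; lra.
  + by rewrite !ltr0_norm; lra.
  + by move: E; set t := df z; nra.
- have [||z] := @MVT _ f df 1 y y1.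
  + by move=> z; rewrite in_itv/= => /andP[yz _]; apply: fdf; exact: lt_trans yz.
  + exact: cf.
  rewrite in_itv/= => /andP[yz z1] E; exists z; split.
  + exact: lt_trans yz.
  + by rewrite mulr_ge0//; lra.
  + by rewrite !gtr0_norm; lra.
  + by [].
- by exists 1; rewrite !subrr !mulr0 normr0.
Qed.

Lemma powR_ge_quarter y (b : R) : 2^-1 <= y <= 3 / 2 -> - 2 <= b <= 0 ->
  4^-1 <= y `^ b.
Proof.
move=> /andP[y1 y2] /andP[b1 b2].
have y0 : 0 < y by lra.
have [y1'|y1'] := leP 1 y.
  have : y `^ (- 2) <= y `^ b by apply: ler_powR.
  move/(le_trans _); apply; rewrite powR_invn ?(ltW y0)//.
  rewrite lef_pV2 ?posrE ?exprn_gt0//.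
  by rewrite expr2; nra.
have : 1 <= y `^ b.
  have := @ger_powR _ y _ b 0 b2; rewrite powRr0; apply.
  by rewrite y0 ltW.
lra.
Qed.

(** Taylor expansion at 1 with a remainder of definite sign, concave for a < 1
    and convex for a > 1. The modulus is linear in |a - 1|, which is what later
    produces the exponent of the logarithm in the borderline case. *)
Lemma powR_second_order a (a0 y : R) : 0 < a0 -> a0 <= a <= 2 ->
  2^-1 <= y <= 3 / 2 ->
  a0 / 8 * `|a - 1| * (y - 1) ^+ 2 <=
  Num.sg (a - 1) * (y `^ a - 1 - a * (y - 1)).
Proof.
move=> a00 /andP[a0a a2] y12; have /andP[y1 y2] := y12.
have y0 : 0 < y by lra.
set s := Num.sg (a - 1); set c := a0 / 8 * `|a - 1|.
have sE : s * (a - 1) = `|a - 1| by rewrite -normrEsg.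
pose f : R -> R := s *: (fun z : R => z `^ a) - (s * a - 2 * c) *: id - c *: (id * id).
(* f is the difference of the two sides, up to an additive constant. *)
pose df z := s * (a * z `^ (a - 1)) - (s * a - 2 * c) - c * (z + z).
have fdf (z : R) : 0 < z -> is_derive z 1 f (df z).
  move=> z0.
  have D1 := is_derive1_powR a z0.
  apply: is_derive_eq.
  rewrite /df /GRing.scale/=; ring.
have [z [z0 zy zn E]] := MVT_from1 y0 fdf.
have z12 : 2^-1 <= z <= 3 / 2.
  have : `|y - 1| <= 2^-1 by rewrite ler_norml; apply/andP; split; lra.
  move=> /(le_trans zn); rewrite ler_norml => /andP[h1 h2].
  by apply/andP; split; lra.
pose g : R -> R := (fun z : R => z `^ (a - 1)).
have gdg (w : R) : 0 < w -> is_derive w 1 g ((a - 1) * w `^ (a - 2)).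
  move=> w0; have := is_derive1_powR (a - 1) w0.
  by rewrite (_ : a - 1 - 1 = a - 2); last by ring.
have [w [w0 wz wn F]] := MVT_from1 z0 gdg.
have w12 : 2^-1 <= w <= 3 / 2.
  have : `|z - 1| <= 2^-1 by rewrite ler_norml; case/andP: z12 => ? ?; apply/andP; split; lra.
  move=> /(le_trans wn); rewrite ler_norml => /andP[h1 h2].
  by apply/andP; split; lra.
have wq : 4^-1 <= w `^ (a - 2) by apply: powR_ge_quarter => //; apply/andP; split; lra.
have fE : f y - f 1 = s * (y `^ a - 1 - a * (y - 1)) - c * (y - 1) ^+ 2.
  rewrite /f !fctE /GRing.scale/= !powR1/=; ring.
have dfE : df z = `|a - 1| * (z - 1) * (a * w `^ (a - 2) - a0 / 4).
  have gz : z `^ (a - 1) = 1 + (a - 1) * w `^ (a - 2) * (z - 1).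
    by move: F; rewrite /g powR1 => F; rewrite -F; ring.
  by rewrite /df gz -sE /c -sE; field.
suff : 0 <= f y - f 1 by rewrite fE subr_ge0.
rewrite E dfE mulrAC mulr_ge0//; first by rewrite -mulrA mulr_ge0.
rewrite subr_ge0 ler_pM//; lra.
Qed.

Lemma powR_lipschitz a (D y1 y2 : R) : 1 < a <= 2 -> 1 <= D ->
  0 < y1 <= y2 -> y2 <= D -> y2 `^ a - y1 `^ a <= 2 * D * (y2 - y1).
Proof.
move=> /andP[a1 a2] D1 /andP[y10 y12] y2D.
have [z|z|z Hz ->] := @MVT_segment _ (fun y => y `^ a) (fun y => a * y `^ (a - 1)) y1 y2 y12.
- by rewrite in_itv/= => /andP[yz _]; apply: is_derive1_powR; exact: lt_trans yz.
- apply: derivable_within_continuous => w; rewrite in_itv/= => /andP[yw _].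
  by have [] := is_derive1_powR a (lt_le_trans y10 yw).
move: Hz; rewrite in_itv/= => /andP[yz zy].
rewrite ler_wpM2r ?subr_ge0// ler_pM ?powR_ge0//; first by lra.
have z0 : 0 < z by exact: lt_le_trans yz.
apply: (@le_trans _ _ (D `^ (a - 1))).
  apply: ge0_ler_powR; rewrite ?nnegrE; try lra.
rewrite -[leRHS]powRr1; last by lra.
by apply: ler_powR => //; lra.
Qed.

Lemma powR_ratio (t e : R) (m : nat) : 2^-1 <= t <= 2 -> - m%:R <= e <= m%:R ->
  t `^ e <= 2 ^+ m.
Proof.
move=> /andP[t1 t2] /andP[e1 e2]; have t0 : 0 < t by lra.
have [h|h] := leP 1 t.
  apply: (@le_trans _ _ (t `^ m%:R)); first exact: ler_powR.
  rewrite powR_mulrn; last by lra.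
  by rewrite lerXn2r ?nnegrE//; lra.
apply: (@le_trans _ _ (t `^ (- m%:R))).
  by apply: ger_powR => //; lra.
rewrite powR_invn; last by lra.
rewrite -exprVn lerXn2r ?nnegrE ?invr_ge0//; first by lra.
by rewrite -[leRHS]invrK lef_pV2 ?posrE ?invr_gt0//; lra.
Qed.

End powR_calculus.

(** * The barrier *)

Section barrier.
Variables (R : realType) (n : nat) (Omega : set 'rV[R]_n).
Hypothesis hn : (0 < n)%N.
Hypothesis hO : bounded_convex_domain Omega.
Variable D : R.
Hypothesis D1 : 1 <= D.
Hypothesis hD : forall x, Omega x -> enorm x <= D /\ dist_frontier Omega x <= D.
Variables a0 a : R.
Hypothesis a00 : 0 < a0.
Hypothesis a0a : a0 <= a <= 2.
Hypothesis a1 : a != 1.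
Implicit Types x y z : 'rV[R]_n.
Local Notation d := (dist_frontier Omega).

(** The sign s makes - s d^a concave in d, and for a > 1 the term A d keeps the
    barrier increasing in d. The factor H adds curvature in the directions in
    which d^a is flat; delta is so small that the mixed second-order terms are
    absorbed by the pure ones. *)
Let s : R := Num.sg (a - 1).
Let c1 : R := a0 / 8.
Let delta : R := c1 * `|a - 1| / (64 * D ^+ 2).
Let A : R := if 1 < a then 8 * D else 0.
Let H x : R := 1 + s * delta * dotp x x.

Definition barrier x : R := A * d x - s * d x `^ a * H x.

Definition barrier_cst : R := a0 / (2048 * D ^+ 2).

Let a_gt0 : 0 < a. Proof. by case/andP: a0a => ? _; exact: lt_le_trans a00 _. Qed.

Let am1 : 0 < `|a - 1| <= 1.
Proof.
rewrite normr_gt0 subr_eq0 a1/= ler_norml; case/andP: a0a => h1 h2.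
by have a_pos := a_gt0; apply/andP; split; lra.
Qed.

Let delta_gt0 : 0 < delta.
Proof.
have D1' := D1; have a00' := a00.
have /andP[am _] := am1.
by rewrite /delta /c1 divr_gt0// !mulr_gt0//; lra.
Qed.

Let deltaE : 16 * delta * D ^+ 2 = c1 / 4 * `|a - 1|.
Proof.
have D0 : D != 0 by rewrite gt_eqF//; exact: lt_le_trans D1.
by rewrite /delta; field.
Qed.

Let s2 : s = 1 \/ s = - 1.
Proof.
have [h|h|h] := ltgtP (a - 1) 0.
- by right; rewrite /s ltr0_sg.
- by left; rewrite /s gtr0_sg.
- by move: a1; rewrite -subr_eq0 h eqxx.
Qed.

Let H_itv x : Omega x -> 2^-1 <= H x <= 2.
Proof.
have D1' := D1; have a00' := a00.
move=> Ox; have [xD _] := hD Ox.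
have x2 : dotp x x <= D ^+ 2.
  by rewrite -sqr_enorm lerXn2r ?nnegrE ?enorm_ge0//; lra.
have := dotp_ge0 x; have /andP[am0 am'] := am1.
have dD : delta * D ^+ 2 <= 1 / 64.
  have h : c1 * `|a - 1| <= 1.
    by rewrite /c1; case/andP: a0a => ? ?; nra.
  by have := deltaE; lra.
have dx : delta * dotp x x <= 1 / 64.
  by apply: le_trans dD; rewrite ler_pM2l.
move=> h; have dx0 : 0 <= delta * dotp x x by rewrite mulr_ge0// ltW.
rewrite /H -mulrA; move: (delta * _) dx dx0 => w h1 h2.
by case: s2 => ->; apply/andP; split; lra.
Qed.

Lemma barrier_frontier x : frontier Omega x -> barrier x = 0.
Proof.
move=> fx; rewrite /barrier (dist_frontier0 hn hO fx).
by rewrite powR0 ?gt_eqF// !mulr0 mul0r subr0.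
Qed.

Lemma barrier_le_pow x : Omega x -> a < 1 -> barrier x <= d x `^ a.
Proof.
move=> Ox al; rewrite /barrier /A ltNge (ltW al)/= mul0r sub0r.
have s1 : s = - 1 by rewrite /s ltr0_sg//; lra.
have hH : H x <= 1.
  rewrite /H s1 mulN1r mulNr lerBlDr lerDl mulr_ge0 ?dotp_ge0//; exact: ltW.
by rewrite s1 mulN1r mulNr opprK ler_piMr ?powR_ge0.
Qed.

Lemma barrier_le_lin x : Omega x -> 1 < a -> barrier x <= 8 * D * d x.
Proof.
move=> Ox al; rewrite /barrier /A al.
have s1 : s = 1 by rewrite /s gtr0_sg//; lra.
have /andP[hH _] := H_itv Ox.
rewrite s1 mul1r lerBlDr lerDl mulr_ge0 ?powR_ge0//; lra.
Qed.

Lemma dist_powR_continuous : continuous (fun x => d x `^ a).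
Proof.
move=> x; have FF : Filter (nbhs x) by exact: nbhs_filter.
have [dx|dx] := eqVneq (d x) 0.
  apply/(@cvgrPdist_lt _ _ _ (nbhs x) FF) => e e0.
  rewrite dx powR0 ?gt_eqF//.
  have e1 : 0 < e `^ a^-1 by exact: powR_gt0.
  have := @dist_continuous _ _ _ hn hO x.
  move=> /(@cvgrPdist_lt _ _ _ (nbhs x) FF)/(_ _ e1).
  apply: filterS => y; rewrite dx !sub0r => dy.
  have dy0 : 0 <= d y by exact: dist_ge0.
  rewrite normrN (ger0_norm dy0) in dy.
  rewrite normrN (ger0_norm (powR_ge0 _ _)).
  have := @gt0_ltr_powR _ a a_gt0 _ _ _ _ dy.
  rewrite !nnegrE dy0 (ltW e1) => /(_ isT isT).
  by rewrite -powRrM mulVf ?gt_eqF// powRr1// ltW.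
have dx0 : 0 < d x by rewrite lt_neqAle eq_sym dx; exact: dist_ge0.
apply: (@continuous_comp _ _ _ d (fun t => t `^ a)).
  exact: dist_continuous.
apply: differentiable_continuous; apply/derivable1_diffP.
by have [] := is_derive1_powR a dx0.
Qed.

Lemma barrier_continuous : continuous barrier.
Proof.
have cc (r : R) x : {for x, continuous (fun _ : 'rV[R]_n => r)}.
  exact: cst_continuous.
have cd x : {for x, continuous d} by exact: dist_continuous.
have cp x : {for x, continuous (fun y => d y `^ a)}.
  exact: dist_powR_continuous.
have cn x : {for x, continuous (fun y : 'rV[R]_n => dotp y y)}.
  move: x; apply: continuous_big => [|i _ y]; first exact: add_continuous.
  by apply: (@continuousM _ _ (fun y : 'rV[R]_n => y 0 i)); exact: coord_continuous.
have cH x : {for x, continuous H}.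
  exact: (continuousD (cc 1 x) (continuousM (cc (s * delta) x) (cn x))).
move=> x; exact: (continuousB (continuousM (cc A x) (cd x))
  (continuousM (continuousM (cc s x) (cp x)) (cH x))).
Qed.

(** The barrier is monotone in d, so d may be replaced by its supporting affine
    function, which equals d x0 (1 + tau) with tau = nu.h / d x0. The power
    (1 + tau)^a gives the curvature in the direction nu, the quadratic part of
    H the curvature in all directions, and the cross term tau (x0.h) is
    absorbed by both. *)
Lemma barrier_local x0 : Omega x0 ->
  exists nu L : 'rV[R]_n, enorm nu = 1 /\
  forall x, enorm (x - x0) <= d x0 / 4 ->
    barrier x <= barrier x0 + dotp L (x - x0) -
      barrier_cst * `|a - 1| * d x0 `^ a *
      (enorm (x - x0) ^+ 2 + (dotp nu (x - x0) / (d x0 / D)) ^+ 2).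
Proof.
have D1' := D1; have a00' := a00; have a_pos := a_gt0.
move=> O0; have [nu enu hnu] := dist_support hn hO O0.
have d0 := dist_gt0 hn hO O0.
have [x0D d0D] := hD O0.
set d_ := d x0 in d0 d0D hnu *.
pose L := (A - s * d_ `^ a * H x0 * (a / d_)) *: nu - (2 * delta * d_ `^ a) *: x0.
exists nu, L; split => // x hx.
have Ox : Omega x by apply: (dist_ball hO O0); apply: le_lt_trans hx _; lra.
have [h hxE] : exists h, x - x0 = h by exists (x - x0).
have xE : x = x0 + h by rewrite -hxE addrC subrK.
have hnux := hnu x Ox; rewrite !hxE in hx hnux *.
pose tau := dotp nu h / d_.
have nuh : dotp nu h = tau * d_ by rewrite divfK// gt_eqF.
have tau4 : `|tau| <= 4^-1.
  rewrite normrM normfV (gtr0_norm d0) ler_pdivrMr//.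
  apply: le_trans (normr_dotp_le _ _) _; rewrite enu mul1r.
  by apply: le_trans hx _; lra.
have /andP[t1 t2] : - 4^-1 <= tau <= 4^-1 by rewrite -ler_norml.
set l := d_ * (1 + tau).
have l0 : 0 < l by rewrite mulr_gt0//; lra.
have dx0 := dist_gt0 hn hO Ox.
have dl : d x <= l by rewrite /l mulrDr mulr1 [d_ * tau]mulrC -nuh.
have HI := H_itv Ox.
have mono : barrier x <= A * l - s * l `^ a * H x.
  rewrite /barrier /A; case: ifP => al.
    have s1 : s = 1 by rewrite /s gtr0_sg//; lra.
    have l2D : l <= 2 * D by rewrite /l; nra.
    have aI : 1 < a <= 2 by rewrite al; case/andP: a0a.
    have dlI : 0 < d x <= l by rewrite dx0.
    have := @powR_lipschitz _ a (2 * D) (d x) l aI _ dlI l2D.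
    rewrite s1 !mul1r => /(_ ltac:(lra)).
    case/andP: HI => h1 h2 h3.
    have : 0 <= H x * (l `^ a - d x `^ a) <= 2 * (2 * (2 * D) * (l - d x)).
      have le0 : 0 <= l `^ a - d x `^ a.
        rewrite subr_ge0; apply: ge0_ler_powR; rewrite ?nnegrE; lra.
      apply/andP; split; first by rewrite mulr_ge0//; lra.
      by apply: ler_pM => //; lra.
    by move=> /andP[_]; lra.
  have s1 : s = - 1.
    rewrite /s ltr0_sg// subr_lt0 lt_neqAle a1/= leNgt al//.
  rewrite !mul0r !sub0r s1 !mulN1r !mulNr !opprK ler_wpM2r//.
    by case/andP: HI => h1 _; lra.
  by apply: ge0_ler_powR; rewrite ?nnegrE; lra.
apply: le_trans mono _.
have lE : l `^ a = d_ `^ a * (1 + tau) `^ a by rewrite powRM//; lra.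
set P := d_ `^ a in lE L *; have P0 : 0 < P by exact: powR_gt0.
(* E is the second-order remainder of the power in the direction nu. *)
have := @powR_second_order _ a a0 (1 + tau) a00 a0a.
have -> : 1 + tau - 1 = tau by ring.
have tI : 2^-1 <= 1 + tau <= 3 / 2 by apply/andP; split; lra.
move=> /(_ tI); rewrite -/s -/c1; set E := _ `^ a - 1 - a * tau => hE.
have powE : (1 + tau) `^ a = 1 + a * tau + E by rewrite /E; ring.
have ss : s * s = 1 by case: s2 => ->; lra.
have HE : H x = H x0 + s * delta * (2 * dotp x0 h + enorm h ^+ 2).
  by rewrite /H xE !dotpE -(sqr_enorm h) (dotpC h x0); ring.
set H0 := H x0; set X := dotp x0 h; set N := enorm h ^+ 2.
have Xb : `|X| <= D * enorm h.
  apply: le_trans (normr_dotp_le _ _) _.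
  by rewrite ler_wpM2r// enorm_ge0.
have e0 := enorm_ge0 h.
have cross : - (4^-1 * N + 16 * D ^+ 2 * tau ^+ 2) <= 2 * a * tau * X.
  have b1 : `|2 * a * tau * X| <= 4 * `|tau| * (D * enorm h).
    rewrite normrM ler_pM// !normrM ler_wpM2r// ger0_norm// ger0_norm//.
      by case/andP: a0a => _; lra.
    exact: ltW.
  have b2 : 4 * `|tau| * (D * enorm h) <= 4^-1 * N + 16 * D ^+ 2 * tau ^+ 2.
    have := sqr_ge0 (enorm h / 2 - 4 * (D * `|tau|)).
    rewrite -(real_normK (num_real tau)) /N; lra.
  by have := ler_norm (- (2 * a * tau * X)); rewrite normrN; lra.
have /andP[am0 am'] := am1; have /andP[Hx1 Hx2] := HI.
have c10 : 0 <= c1 by rewrite /c1 divr_ge0// ltW.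
have cc := mulr_ge0 (mulr_ge0 c10 (normr_ge0 (a - 1))) (sqr_ge0 tau).
have normal : c1 / 2 * `|a - 1| * tau ^+ 2 <= s * E * H x.
  apply: (@le_trans _ _ (c1 * `|a - 1| * tau ^+ 2 * 2^-1)); first by lra.
  apply: ler_pM => //.
have N0 : 0 <= N by exact: sqr_ge0.
have tang : N / 2 <= (1 + a * tau) * N.
  rewrite mulrC ler_wpM2r//.
  have : - (2 * 4^-1) <= a * tau.
    have : `|a * tau| <= 2 * 4^-1.
      rewrite normrM (gtr0_norm a_pos); apply: ler_pM => //; first exact: ltW.
      by case/andP: a0a.
    by rewrite ler_norml => /andP[].
  by lra.
have D0 : D != 0 by rewrite gt_eqF//; exact: lt_le_trans D1.
have dN0 : d_ != 0 by rewrite gt_eqF.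
have -> : dotp nu h / (d_ / D) = tau * D.
  by rewrite nuh; field; rewrite ?dN0 ?D0.
have -> : barrier_cst * `|a - 1| * P * (enorm h ^+ 2 + (tau * D) ^+ 2) =
    P * (delta / 4 * N + c1 / 256 * `|a - 1| * tau ^+ 2).
  by rewrite /barrier_cst /delta /c1 /N; field.
have -> : barrier x0 + dotp L h = A * l - P * (s * H0 * (1 + a * tau) + 2 * delta * X).
  by rewrite /barrier /L !dotpE nuh -/d_ -/P -/H0 -/X /l; field; rewrite ?dN0 ?D0.
have -> : s * l `^ a * H x = P * (s * H0 * (1 + a * tau) + 2 * delta * X +
    (delta * (2 * a * tau * X) + delta * ((1 + a * tau) * N) + s * E * H x)).
  rewrite lE powE.
  have -> : s * (P * (1 + a * tau + E)) * H x =
    P * (s * (1 + a * tau) * H x + s * E * H x) by ring.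
  rewrite {1}HE -/H0 -/X -/N.
  have -> : s * (1 + a * tau) * (H0 + s * delta * (2 * X + N)) =
    s * H0 * (1 + a * tau) + (s * s) * delta * (1 + a * tau) * (2 * X + N) by ring.
  by rewrite ss; ring.
rewrite [leLHS](_ : _ = A * l - P * (s * H0 * (1 + a * tau) + 2 * delta * X) -
  P * (delta * (2 * a * tau * X) + delta * ((1 + a * tau) * N) + s * E * H x));
  last by ring.
rewrite lerD2l lerN2 ler_pM2l//.
have dC := ler_wpM2l (ltW delta_gt0) cross.
have dT := ler_wpM2l (ltW delta_gt0) tang.
have dE' := congr1 (fun w => w * tau ^+ 2) deltaE.
have dN : 0 <= delta * N by rewrite mulr_ge0// ltW.
have dC' : - (delta * N / 4 + 16 * delta * D ^+ 2 * tau ^+ 2) <=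
  delta * (2 * a * tau * X) by apply: le_trans dC; lra.
have dT' : delta * N / 2 <= delta * ((1 + a * tau) * N).
  by apply: le_trans dT; lra.
rewrite /= in dE'; rewrite dE' in dC'.
have gE : delta / 4 * N + c1 / 256 * `|a - 1| * tau ^+ 2 =
  delta * N / 4 + c1 * `|a - 1| * tau ^+ 2 / 256 by field.
have nE : c1 / 2 * `|a - 1| * tau ^+ 2 = c1 * `|a - 1| * tau ^+ 2 / 2 by field.
have cE : c1 / 4 * `|a - 1| * tau ^+ 2 = c1 * `|a - 1| * tau ^+ 2 / 4 by field.
rewrite nE in normal; rewrite cE in dC'; rewrite gE.
move: dC' dT' cc dN normal.
move: (delta * (2 * a * tau * X)) (delta * ((1 + a * tau) * N)) (s * E * H x).
move: (c1 * `|a - 1| * tau ^+ 2) (delta * N) => r q w1 w2 w3 *.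
lra.
Qed.

End barrier.

(** * Comparison with the barrier *)

Lemma barrier_cst_gt0 (R : realType) (D a0 : R) : 0 < D -> 0 < a0 ->
  0 < barrier_cst D a0.
Proof.
move=> D0 a00; have h1 : 0 < 2048 :> R by rewrite ltr0n.
exact: divr_gt0 a00 (mulr_gt0 h1 (exprn_gt0 2 D0)).
Qed.

Section comparison.
Variables (R : realType) (n : nat) (Omega : set 'rV[R]_n).
Variables (alpha p M : R) (u : 'rV[R]_n -> R).
Hypothesis hn : (0 < n)%N.
Hypothesis hO : bounded_convex_domain Omega.
Hypothesis hM : 0 < M.
Hypothesis hu : convex_solution Omega alpha p M u.
Variable D : R.
Hypothesis D1 : 1 <= D.
Hypothesis hD : forall x, Omega x -> enorm x <= D /\ dist_frontier Omega x <= D.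
Implicit Types x y z : 'rV[R]_n.
Local Notation d := (dist_frontier Omega).
Local Notation density := (ma_density Omega alpha p M u).

Lemma normr_solution x : Omega x -> `|u x| = - u x.
Proof.
by move=> Ox; rewrite ler0_norm// (solution_le0 hn hO hu)//; exact: subset_closure.
Qed.

(** If u + K f had a negative minimum over the closure, at x0 say, then
    u would touch there from above a quadratic function as in
    [quadratic_touching_bound], with B = K barrier_cst |a - 1| (d x0)^a and
    rho = d x0 / D. Both B^n and rho^2 times the density scale like
    (d x0)^(n a), so that the bound fails for large K. *)
Lemma barrier_comparison (a0 a Lam K : R) : 0 < a0 -> a0 <= a <= 2 -> a != 1 ->
  0 <= Lam -> (forall x, Omega x -> density x <= Lam * d x `^ (n%:R * a - 2)) ->
  0 < K -> 2 ^+ (3 * n + 4) * Lam < (K * barrier_cst D a0 * `|a - 1|) ^+ n ->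
  forall x, Omega x -> `|u x| <= K * barrier Omega D a0 a x.
Proof.
move=> a00 a0a a1 Lam0 hLam K0 KLam x1 Ox1.
have nE : (3 * n + 4 = n.+2 + (2 * n + 2))%N by clear; lia.
rewrite normr_solution// leNgt; apply/negP => neg.
set f := barrier Omega D a0 a in neg.
pose g x := u x + K * f x.
have cg : {within closure Omega, continuous g}.
  case: hu => cu _ _ _.
  apply: (@within_continuousD _ _ _ _ u (fun x => K * f x) cu).
  apply: continuous_subspaceT => x; apply: continuousM; first exact: cst_continuous.
  exact: barrier_continuous.
have c0 : closure Omega !=set0 by exists x1; exact: subset_closure.
have [x0] := EVT_min_rV c0 (closure_compact hO) cg.
rewrite inE => cx0 gmin.
have g0 : g x0 < 0.
  have : g x0 <= g x1 by apply: gmin; rewrite inE; exact: subset_closure.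
  by move=> /le_lt_trans; apply; rewrite /g; lra.
have O0 : Omega x0.
  have /closure_domain[//|fx] := cx0.
  move: g0; rewrite /g /f (barrier_frontier hn hO D a00 a0a fx) mulr0 addr0.
  by case: hu => _ _ _ ->//; rewrite ltxx.
have [nu [L [enu loc]]] := barrier_local hn hO D1 hD a00 a0a a1 O0.
have d0 := dist_gt0 hn hO O0; have [_ d0D] := hD O0.
have am : 0 < `|a - 1| by rewrite normr_gt0 subr_eq0.
have D0 : 0 < D by exact: lt_le_trans D1.
move: KLam loc (barrier_cst_gt0 D0 a00).
move: (barrier_cst D a0) => kk KLam loc k0.
set P := d x0 `^ a in loc; have P0 : 0 < P by exact: powR_gt0.
pose B := K * kk * `|a - 1| * P.
have B0 : 0 < B by rewrite !mulr_gt0.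
have rho01 : 0 < d x0 / D <= 1 by rewrite divr_gt0//= ler_pdivrMr// mul1r.
have r0 : 0 < d x0 / 4 < d x0 by apply/andP; split; lra.
pose Lam' := Lam * (d x0 `^ (n%:R * a - 2) * 2 ^+ (2 * n + 2)).
have dens x : enorm (x - x0) <= d x0 / 4 -> density x <= Lam'.
  move=> hx; have Ox : Omega x.
    by apply: (dist_ball hO O0); case/andP: r0 => _; exact: le_lt_trans.
  apply: le_trans (hLam _ Ox) _; rewrite ler_wpM2l//.
  have l1 := dist_lip hn hO x x0; have l2 := dist_lip hn hO x0 x.
  rewrite enorm_sub in l2.
  have -> : d x = d x0 * (d x / d x0) by rewrite mulrC divfK// gt_eqF.
  have dx0 := dist_gt0 hn hO Ox.
  rewrite powRM ?(ltW d0) ?divr_ge0 ?(ltW dx0)// ?(ltW d0)//.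
  rewrite ler_wpM2l ?powR_ge0//.
  (* On the ball of radius d x0 / 4 the distance changes by a factor at most 2. *)
  apply: powR_ratio.
    by rewrite ler_pdivlMr// ler_pdivrMr//; apply/andP; split; lra.
  have n0 : 0 <= n%:R :> R by [].
  have /andP[h1 h2] := a0a.
  rewrite natrD natrM; apply/andP; split; nra.
have touch x : enorm (x - x0) <= d x0 / 4 ->
    u x0 + dotp (- K *: L) (x - x0) +
     B * (enorm (x - x0) ^+ 2 + (dotp nu (x - x0) / (d x0 / D)) ^+ 2) <= u x.
  move=> hx; have Ox : Omega x.
    by apply: (dist_ball hO O0); case/andP: r0 => _; exact: le_lt_trans.
  have : g x0 <= g x by apply: gmin; rewrite inE; exact: subset_closure.
  have := ler_wpM2l (ltW K0) (loc x hx); rewrite /g -/f dotpZl /B.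
  move: (enorm _ ^+ 2 + _) (dotp L _) (f x) (f x0) => q w f1 f0; lra.
have := quadratic_touching_bound hO hM hu O0 enu B0 rho01 r0 touch dens.
apply/negP; rewrite -ltNge.
have Pn : P ^+ n = d x0 `^ (n%:R * a - 2) * d x0 ^+ 2.
  rewrite -!powR_mulrn ?(ltW P0) ?(ltW d0)// -powRrM -powRD.
    by congr (_ `^ _); ring.
  by rewrite (gt_eqF d0) implybT.
rewrite /B [ltRHS]exprMn.
apply: le_lt_trans (_ : 2 ^+ (3 * n + 4) * Lam * P ^+ n < _); last first.
  by rewrite ltr_pM2r// exprn_gt0.
rewrite Pn /Lam' expr_div_n.
rewrite nE (exprD _ n.+2).
set q := d x0 `^ _; have q0 : 0 < q by exact: powR_gt0.
set e1 := (2 : R) ^+ n.+2; set e2 := (2 : R) ^+ (2 * n + 2).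
have -> : e1 * (d x0 ^+ 2 / D ^+ 2) * (Lam * (q * e2)) =
  (e1 * e2 * Lam * (q * d x0 ^+ 2)) / D ^+ 2 by ring.
rewrite ler_pdivrMr ?exprn_gt0// ler_peMr//; last by have := D1; rewrite expr2; nra.
have e10 : 0 <= e1 by exact: exprn_ge0.
have e20 : 0 <= e2 by exact: exprn_ge0.
exact: mulr_ge0 (mulr_ge0 (mulr_ge0 e10 e20) Lam0) (mulr_ge0 (ltW q0) (sqr_ge0 _)).
Qed.

Lemma density_decay (a b K : R) : 0 <= alpha -> 0 < p -> 0 <= b <= 1 -> 0 < a ->
  0 < K -> n%:R * a - 2 <= p * b - alpha ->
  (forall x, Omega x -> `|u x| <= K * d x `^ b) ->
  forall x, Omega x ->
    density x <= M * K `^ p * D `^ (p + 2) * d x `^ (n%:R * a - 2).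
Proof.
move=> al0 p0 /andP[b0 b1] a0 K0 hab hK x Ox.
have d0 := dist_gt0 hn hO Ox; have [_ dD] := hD Ox.
have K0' : 0 <= K by exact: ltW.
rewrite /ma_density -!mulrA ler_pM2l//.
apply: (@le_trans _ _ (K `^ p * d x `^ (p * b) * d x `^ (- alpha))).
  rewrite ler_wpM2r ?powR_ge0//.
  have h : `|u x| `^ p <= (K * d x `^ b) `^ p.
    apply: ge0_ler_powR; rewrite ?nnegrE ?(ltW p0)//; last exact: hK.
    by rewrite mulr_ge0 ?powR_ge0.
  by move: h; rewrite powRM ?powR_ge0// -powRrM (mulrC b).
rewrite -mulrA ler_wpM2l ?powR_ge0//.
have E : forall s r : R, d x `^ (s + r) = d x `^ s * d x `^ r.
  by move=> s r; rewrite powRD// (gt_eqF d0) implybT.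
rewrite -E; set e := p * b - alpha.
have -> : e = (e - (n%:R * a - 2)) + (n%:R * a - 2) by ring.
rewrite E ler_wpM2r ?powR_ge0//.
have n0 : 0 <= n%:R * a by rewrite mulr_ge0// ltW.
apply: (@le_trans _ _ (D `^ (e - (n%:R * a - 2)))).
  by apply: ge0_ler_powR; rewrite ?nnegrE ?subr_ge0// ?(ltW d0)//; have := D1; lra.
apply: ler_powR => //; rewrite /e; nra.
Qed.

End comparison.

(** * Improvement of decay *)

Section decay.
Variables (R : realType) (n : nat) (Omega : set 'rV[R]_n).
Variables (alpha p : R).
Hypothesis hn : (2 <= n)%N.
Hypothesis hO : bounded_convex_domain Omega.
Hypothesis halpha : 0 <= alpha < 2.
Hypothesis hp : 0 < p.
Implicit Types x y z : 'rV[R]_n.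
Local Notation d := (dist_frontier Omega).

Let n0 : (0 < n)%N. Proof. exact: ltnW. Qed.
Let nR : 2 <= n%:R :> R. Proof. by rewrite (ler_nat _ 2). Qed.
Let al0 : 0 <= alpha. Proof. by case/andP: halpha. Qed.

(** The basic improvement step: a bound by d^b controls the density, and the
    density controls u through the barrier of exponent a. The constant depends
    on a only through |a - 1| and a lower bound a0. *)
Lemma decay_barrier (a0 : R) : 0 < a0 -> exists D C : R, [/\ 1 <= D, 0 < C &
  (forall x, Omega x -> enorm x <= D /\ d x <= D) /\
  forall (M : R) (u : 'rV[R]_n -> R) (a b K : R),
    0 < M -> convex_solution Omega alpha p M u ->
    a0 <= a <= 2 -> a != 1 -> 0 <= b <= 1 -> 0 < K ->
    n%:R * a - 2 <= p * b - alpha ->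
    (forall x, Omega x -> `|u x| <= K * d x `^ b) ->
    forall x, Omega x ->
      `|u x| <= C / `|a - 1| * (M * K `^ p) `^ n%:R^-1 * barrier Omega D a0 a x].
Proof.
move=> a00; have [D D1 hD] := dist_bounded n0 hO.
have D0 : 0 < D by exact: lt_le_trans D1.
pose c := D `^ ((p + 2) / n%:R).
have c0 : 0 < c by exact: powR_gt0.
have k0 := barrier_cst_gt0 D0 a00.
exists D, (2 ^+ 8 / barrier_cst D a0 * c).
have e8 : 0 < (2 : R) ^+ 8 by exact: exprn_gt0.
split; [by []|exact: mulr_gt0 (divr_gt0 e8 k0) c0|split; first exact: hD].
move=> M u a b K M0 hu a0a a1 b01 K0 hab hK x Ox.
have nne : n%:R != 0 :> R by rewrite pnatr_eq0 -lt0n.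
have a_gt0 : 0 < a by case/andP: a0a => + _; exact: lt_le_trans.
have hdens := density_decay n0 hO M0 D1 hD al0 hp b01 a_gt0 K0 hab hK.
set Lam := M * K `^ p * D `^ (p + 2) in hdens.
have Kp : 0 < M * K `^ p by rewrite mulr_gt0// powR_gt0.
have Lam0 : 0 < Lam by rewrite mulr_gt0// powR_gt0.
have am : 0 < `|a - 1| by rewrite normr_gt0 subr_eq0.
have LamE : Lam `^ n%:R^-1 = (M * K `^ p) `^ n%:R^-1 * c.
  by rewrite /Lam powRM ?powR_ge0 ?(ltW Kp)// -(powRrM D).
have L0 : 0 < Lam `^ n%:R^-1 by exact: powR_gt0.
have -> : 2 ^+ 8 / barrier_cst D a0 * c / `|a - 1| * (M * K `^ p) `^ n%:R^-1 =
  2 ^+ 8 / barrier_cst D a0 / `|a - 1| * Lam `^ n%:R^-1 by rewrite LamE; ring.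
have KK : 0 < 2 ^+ 8 / barrier_cst D a0 / `|a - 1| * Lam `^ n%:R^-1.
  exact: mulr_gt0 (divr_gt0 (divr_gt0 e8 k0) am) L0.
apply: (barrier_comparison n0 hO M0 hu D1 hD a00 a0a a1 (ltW Lam0) hdens KK _ Ox).
have -> : 2 ^+ 8 / barrier_cst D a0 / `|a - 1| * Lam `^ n%:R^-1 * barrier_cst D a0 *
  `|a - 1| = 2 ^+ 8 * Lam `^ n%:R^-1.
  move: (barrier_cst D a0) ((2 : R) ^+ 8) k0 => k e k0.
  by field; rewrite !gt_eqF.
rewrite exprMn -[X in _ < _ * X]powR_mulrn ?ltW// -powRrM mulVf// powRr1 ?(ltW Lam0)//.
rewrite ltr_pM2r//.
(* The factor 2^8 was chosen because 3 n + 4 < 8 n. *)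
rewrite -exprM ltr_eXn2l ?ltr1n//.
by move: hn; clear; lia.
Qed.

Lemma decay_step (a0 : R) : 0 < a0 -> exists2 C : R, 0 < C &
  forall (M : R) (u : 'rV[R]_n -> R) (a b K : R),
    0 < M -> convex_solution Omega alpha p M u ->
    a0 <= a < 1 -> 0 <= b <= 1 -> 0 < K ->
    n%:R * a - 2 <= p * b - alpha ->
    (forall x, Omega x -> `|u x| <= K * d x `^ b) ->
    forall x, Omega x ->
      `|u x| <= C / (1 - a) * (M * K `^ p) `^ n%:R^-1 * d x `^ a.
Proof.
move=> a00; have [D [C [D1 C0 [hD H]]]] := decay_barrier a00.
exists C => // M u a b K M0 hu /andP[a0a a1] b01 K0 hab hK x Ox.
have a0a2 : a0 <= a <= 2 by apply/andP; split; lra.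
have ane : a != 1 by rewrite lt_eqF.
have := H M u a b K M0 hu a0a2 ane b01 K0 hab hK x Ox.
have -> : `|a - 1| = 1 - a by rewrite ltr0_norm ?opprB// subr_lt0.
move/le_trans; apply; rewrite ler_wpM2l//.
  by rewrite mulr_ge0 ?powR_ge0// divr_ge0// ?(ltW C0)//; lra.
exact: barrier_le_pow.
Qed.

Lemma decay_step_linear (a : R) : 1 < a <= 2 -> exists2 C : R, 0 < C &
  forall (M : R) (u : 'rV[R]_n -> R) (b K : R),
    0 < M -> convex_solution Omega alpha p M u ->
    0 <= b <= 1 -> 0 < K -> n%:R * a - 2 <= p * b - alpha ->
    (forall x, Omega x -> `|u x| <= K * d x `^ b) ->
    forall x, Omega x -> `|u x| <= C * (M * K `^ p) `^ n%:R^-1 * d x.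
Proof.
move=> /andP[a1 a2]; have [D [C [D1 C0 [hD H]]]] := decay_barrier (@ltr01 R).
have am : 0 < `|a - 1| by rewrite normr_gt0 subr_eq0 gt_eqF.
have CC : 0 < C / `|a - 1| * (8 * D) by rewrite !mulr_gt0 ?invr_gt0//; lra.
exists (C / `|a - 1| * (8 * D)) => // M u b K M0 hu b01 K0 hab hK x Ox.
have aI : 1 <= a <= 2 by rewrite (ltW a1).
have ane : a != 1 by rewrite gt_eqF.
have := H M u a b K M0 hu aI ane b01 K0 hab hK x Ox.
move/le_trans; apply.
have := barrier_le_lin D1 hD (@ltr01 R) aI ane Ox a1.
have Q0 : 0 <= C / `|a - 1| * (M * K `^ p) `^ n%:R^-1.
  by rewrite mulr_ge0 ?powR_ge0// divr_ge0// ltW.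
move=> /(ler_wpM2l Q0) /le_trans; apply.
rewrite le_eqVlt; apply/orP; left; apply/eqP; ring.
Qed.

Definition sup_value (u : 'rV[R]_n -> R) (m : R) : Prop :=
  (exists2 x, Omega x & `|u x| = m) /\ forall x, Omega x -> `|u x| <= m.

Lemma sup_value_exists (M : R) (u : 'rV[R]_n -> R) : 0 < M ->
  convex_solution Omega alpha p M u -> nonzero_on (closure Omega) u ->
  exists2 m : R, 0 < m & sup_value u m.
Proof.
move=> M0 hu [x1 cx1 u1].
have [x0 cx0 umin] := solution_min n0 hO hu.
have u10 : u x1 < 0 by rewrite lt_neqAle u1 (solution_le0 n0 hO hu).
have u00 : u x0 < 0 by apply: le_lt_trans u10; exact: umin.
have O0 : Omega x0.
  have /closure_domain[//|fx] := cx0.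
  by move: u00; case: hu => _ _ _ ->//; rewrite ltxx.
exists (- u x0); first by rewrite oppr_gt0.
split; first by exists x0 => //; rewrite (normr_solution n0 hO hu).
move=> x Ox; rewrite (normr_solution n0 hO hu)// lerN2; apply: umin.
exact: subset_closure.
Qed.

(** On a ball well inside Omega, convexity gives |u| >= t m with t fixed, so the
    measure of the ball is at least c M m^p. On the other hand u takes values
    in [-m, 0] on a larger ball, so its subgradients have size at most m / r. *)
Lemma mass_bound : exists2 C : R, 0 < C &
  forall (M : R) (u : 'rV[R]_n -> R) (m : R), 0 < M ->
    convex_solution Omega alpha p M u -> 0 < m -> sup_value u m ->
    M * m `^ p <= C * m ^+ n.
Proof.
have [D D1 hD] := dist_bounded n0 hO.
have D0 : 0 < D by exact: lt_le_trans D1.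
have [z Oz] : Omega !=set0 by case: hO.
have [nu enu _] := dist_support n0 hO Oz.
have dz := dist_gt0 n0 hO Oz.
pose r := d z / 2; have r0 : 0 < r by rewrite divr_gt0.
pose E := slab_ball nu z r r.
have oE : open E by exact: slab_ball_open.
have Em : (0 < lebesgue_outer E)%E by exact: slab_ball_gt0.
have EM : (lebesgue_outer E < +oo)%E by apply: slab_ball_lty; exact: ltW.
have ball x y : E x -> enorm (y - x) <= r -> Omega y.
  move=> [/= xz _] yx; apply: (dist_ball hO Oz).
  apply: le_lt_trans (ler_enorm_dist x _ _) _.
  have dzE : d z = r + r by rewrite /r; lra.
  by rewrite dzE; lra.
have EO : E `<=` Omega.
  by move=> x Ex; apply: (ball x x Ex); rewrite subrr enorm0 ltW.
(* Continuing the segment from a maximum point x0 of |u| to x by the fraction s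
   of its length ends inside Omega; x is then t of the way back to x0. *)
pose s := r / (2 * D); have s0 : 0 < s by rewrite divr_gt0// mulr_gt0.
pose t := s / (1 + s).
have t0 : 0 < t by rewrite divr_gt0//; lra.
have t01 : 0 <= t <= 1.
  by rewrite (ltW t0)/= ler_pdivrMr; lra.
case eE : (lebesgue_outer E) Em EM => [e| |]//.
rewrite lte_fin => e0 _.
pose w := t `^ p * D `^ (- alpha) * e.
have w0 : 0 < w by rewrite !mulr_gt0 ?powR_gt0.
exists ((4 / r) ^+ n / w); first by rewrite divr_gt0// exprn_gt0// divr_gt0.
move=> M u m M0 hu m0 [[x0 O0 um] umax].
have low x : E x -> M * (t * m) `^ p * D `^ (- alpha) <= ma_density Omega alpha p M u x.
  move=> Ex; have Ox := EO _ Ex.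
  have Oy : Omega (x + s *: (x - x0)).
    apply: (ball x _ Ex); rewrite [x + _]addrC addrK enormZ gtr0_norm//.
    have : enorm (x - x0) <= 2 * D.
      apply: le_trans (ler_enormD _ _) _; rewrite enormN.
      by have := (hD _ Ox).1; have := (hD _ O0).1; lra.
    move=> /(ler_wpM2l (ltW s0)) /le_trans; apply.
    by rewrite /s divfK// gt_eqF// mulr_gt0.
  have := solution_conv hu Oy O0 t01.
  have -> : x + s *: (x - x0) + t *: (x0 - (x + s *: (x - x0))) = x.
    have -> : x0 - (x + s *: (x - x0)) = - ((1 + s) *: (x - x0)).
      by apply/rowP => i; rewrite !mxE; ring.
    rewrite scalerN scalerA divfK ?addrK//.
    by rewrite gt_eqF//; lra.
  have uy := solution_le0 n0 hO hu (subset_closure Oy).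
  have ux0 : u x0 = - m.
    by rewrite -um (normr_solution n0 hO hu)// opprK.
  rewrite ux0 => ux.
  have tm : t * m <= `|u x|.
    rewrite (normr_solution n0 hO hu)//.
    have : (1 - t) * u (x + s *: (x - x0)) <= 0.
      by rewrite mulr_ge0_le0//; case/andP: t01 => _ ?; lra.
    by lra.
  have dx := dist_gt0 n0 hO Ox.
  apply: ler_pM; rewrite ?powR_ge0//; first by rewrite mulr_ge0 ?powR_ge0// ltW.
    rewrite ler_wpM2l ?(ltW M0)//; apply: ge0_ler_powR; rewrite ?nnegrE ?(ltW hp)//.
    by rewrite mulr_ge0 ?ltW.
  rewrite !powRN lef_pV2 ?posrE ?powR_gt0//.
  by apply: ge0_ler_powR; rewrite ?nnegrE ?(ltW dx) ?(ltW D0)//; have [] := hD _ Ox.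
have lam0 : 0 <= M * (t * m) `^ p * D `^ (- alpha).
  by rewrite !mulr_ge0 ?powR_ge0// ltW.
have lower := monge_ampere_ge hu oE EO lam0 low.
have upper : (monge_ampere Omega u E <= ((2 * (2 * m / r)) ^+ n)%:E)%E.
  apply: lebesgue_outer_bounded; first by rewrite divr_ge0 ?mulr_ge0// ltW.
  move=> q [x Ex xq] i; apply: le_lt_trans (normr_coord_le q i) _.
  apply: (@le_lt_trans _ _ (m / r)); last by rewrite ltr_pM2r ?invr_gt0//; lra.
  rewrite ler_pdivlMr//.
  have [->|q0] := eqVneq q 0; first by rewrite enorm0 mul0r ltW.
  have eq : 0 < enorm q by rewrite lt_neqAle eq_sym enorm_eq0 q0 enorm_ge0.
  have Oy : Omega (x + (r / enorm q) *: q).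
    apply: (ball x _ Ex); rewrite addrC addKr.
    by rewrite enormZ gtr0_norm ?divr_gt0// divfK// gt_eqF.
  have := xq _ Oy; rewrite [x + _ - x]addrC addKr dotpZr -sqr_enorm expr2 mulrA divfK ?gt_eqF//.
  have := solution_le0 n0 hO hu (subset_closure Oy).
  have := umax _ (EO _ Ex); rewrite (normr_solution n0 hO hu (EO _ Ex)).
  by rewrite [r * _]mulrC; lra.
have := le_trans lower upper.
rewrite eE -EFinM lee_fin powRM ?(ltW t0) ?(ltW m0)// => key.
have wE : M * (t `^ p * m `^ p) * D `^ (- alpha) * e = M * m `^ p * w.
  by rewrite /w; ring.
rewrite mulrAC ler_pdivlMr// -wE; apply: le_trans key _.
rewrite -exprMn le_eqVlt; apply/orP; left; apply/eqP; congr (_ ^+ n).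
by field; rewrite gt_eqF.
Qed.

Lemma mass_bound_root : exists2 C : R, 0 < C &
  forall (M : R) (u : 'rV[R]_n -> R) (m c : R), 0 < M ->
    convex_solution Omega alpha p M u -> 0 < m -> sup_value u m -> 0 < c ->
    (M * (c * m) `^ p) `^ n%:R^-1 <= (C * c `^ p) `^ n%:R^-1 * m.
Proof.
have [C C0 hC] := mass_bound; exists C => // M u m c M0 hu m0 um c0.
have nn0 : 0 < n%:R :> R by rewrite ltr0n.
have -> : (C * c `^ p) `^ n%:R^-1 * m = (C * c `^ p * m ^+ n) `^ n%:R^-1.
  rewrite [RHS]powRM ?mulr_ge0 ?powR_ge0 ?exprn_ge0 ?(ltW C0) ?(ltW m0)//.
  rewrite -[in RHS](powR_mulrn n (ltW m0)) -powRrM mulfV ?gt_eqF//.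
  by rewrite (powRr1 (ltW m0)).
apply: ge0_ler_powR; rewrite ?nnegrE ?invr_ge0 ?(ltW nn0)//.
- by rewrite mulr_ge0 ?powR_ge0// ltW.
- by rewrite !mulr_ge0 ?powR_ge0 ?exprn_ge0 ?(ltW C0) ?(ltW m0).
rewrite powRM ?(ltW c0) ?(ltW m0)//.
have := ler_wpM2r (powR_ge0 c p) (hC M u m M0 hu m0 um).
by congr (_ <= _); ring.
Qed.

(** On [0, b] the affine function (2 - alpha + p beta) / n exceeds beta by at
    least e > 0, so each improvement step raises the exponent by e until it
    reaches b. *)
Lemma subcritical_decay (b : R) : 0 < b < 1 -> n%:R * b < 2 - alpha + p * b ->
  exists2 C : R, 0 < C &
  forall (M : R) (u : 'rV[R]_n -> R) (m : R), 0 < M ->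
    convex_solution Omega alpha p M u -> 0 < m -> sup_value u m ->
    forall x, Omega x -> `|u x| <= C * m * d x `^ b.
Proof.
move=> /andP[b0 b1] hb; case/andP: halpha => al0' al2.
have nR' := nR; have nn0 : 0 < n%:R :> R by lra.
have p0 := hp.
pose e : R := Num.min (Num.min ((2 - alpha) / n%:R)
  ((2 - alpha + p * b) / n%:R - b)) b.
have e0 : 0 < e.
  have hb' : b * n%:R < 2 - alpha + p * b by rewrite mulrC.
  have g0 : 0 < (2 - alpha) / n%:R by rewrite divr_gt0//; lra.
  by rewrite !lt_min b0 g0 subr_gt0 ltr_pdivlMr// hb'.
have eb : e <= b by rewrite ge_min lexx orbT.
have e1 : n%:R * e <= 2 - alpha.
  by rewrite mulrC -ler_pdivlMr// !ge_min lexx.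
have e2 : n%:R * e <= 2 - alpha + (p - n%:R) * b.
  have : e <= (2 - alpha + p * b) / n%:R - b by rewrite !ge_min lexx orbT.
  by rewrite lerBrDr ler_pdivlMr//; lra.
pose beta j : R := Num.min (j%:R * e) b.
have beta01 j : 0 <= beta j <= b.
  by rewrite le_min ge_min lexx orbT mulr_ge0 ?(ltW b0) ?(ltW e0).
have betaS j : e <= beta j.+1 /\ beta j.+1 <= beta j + e.
  have jE : (j.+1%:R : R) * e = j%:R * e + e by rewrite -natr1; ring.
  have j0 : 0 <= j%:R * e by rewrite mulr_ge0// ltW.
  rewrite /beta jE; move: (j%:R * e) j0 => w w0.
  by case: (leP (w + e) b) => h1; case: (leP w b) => h2; split; lra.
have [C1 C10 hC1] := decay_step e0.
have [C2 C20 hC2] := mass_bound_root.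
have step j : exists2 C : R, 0 < C &
  forall (M : R) (u : 'rV[R]_n -> R) (m : R), 0 < M ->
    convex_solution Omega alpha p M u -> 0 < m -> sup_value u m ->
    forall x, Omega x -> `|u x| <= C * m * d x `^ beta j.
  elim: j => [|j [C C0 IH]].
    exists 1 => // M u m M0 hu m0 [_ um] x Ox.
    have -> : beta 0%N = 0 by rewrite /beta mul0r; exact: min_l (ltW b0).
    by rewrite powRr0 mulr1 mul1r um.
  have [eB BS] := betaS j; have /andP[B0 Bb] := beta01 j.
  have /andP[B0' Bb'] := beta01 j.+1.
  exists (C1 / (1 - b) * (C2 * C `^ p) `^ n%:R^-1).
    by rewrite mulr_gt0 ?powR_gt0 ?mulr_gt0 ?powR_gt0// invr_gt0; lra.
  move=> M u m M0 hu m0 um x Ox.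
  have aI : e <= beta j.+1 < 1 by rewrite eB/=; lra.
  have bI : 0 <= beta j <= 1 by rewrite B0/=; lra.
  have Cm : 0 < C * m by rewrite mulr_gt0.
  have cond : n%:R * beta j.+1 - 2 <= p * beta j - alpha.
    have h := ler_wpM2l (ltW nn0) BS.
    have [pn|pn] := leP n%:R p.
      have : 0 <= (p - n%:R) * beta j by rewrite mulr_ge0//; lra.
      by lra.
    have : (n%:R - p) * beta j <= (n%:R - p) * b by rewrite ler_wpM2l//; lra.
    by lra.
  have := hC1 M u (beta j.+1) (beta j) (C * m) M0 hu aI bI Cm cond
    (IH M u m M0 hu m0 um) x Ox.
  move/le_trans; apply; rewrite ler_wpM2r ?powR_ge0// -[leRHS]mulrA.
  apply: ler_pM; rewrite ?powR_ge0//.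
  - by rewrite divr_ge0 ?(ltW C10)//; lra.
  - by rewrite ler_pM2l// lef_pV2 ?posrE; lra.
  - exact: (hC2 M u m C M0 hu m0 um C0).
pose N := (Num.truncn (b / e)).+1.
have [C C0 hC] := step N; exists C => //.
suff <- : beta N = b by [].
rewrite /beta; apply: min_r.
rewrite -ler_pdivrMr// ltW// truncnS_gt//.
Qed.

(** Let K be the best constant in the bound by d^b, finite by
    [subcritical_decay]. The improvement step with both exponents equal to b
    gives K <= C / (1 - b) (M K^p)^(1/n), and p < n turns this into a bound on
    K. *)
Lemma sharp_power_decay (a0 M : R) : p < n%:R -> 0 < a0 -> 0 < M ->
  exists2 C : R, 0 < C &
  forall u : 'rV[R]_n -> R,
    convex_solution Omega alpha p M u -> nonzero_on (closure Omega) u ->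
    forall b : R, a0 <= b < 1 -> n%:R * b < 2 - alpha + p * b ->
    forall x, Omega x ->
      `|u x| <= (C / (1 - b)) `^ (n%:R / (n%:R - p)) * d x `^ b.
Proof.
move=> pn a00 M0.
have nn0 : 0 < n%:R :> R by have := nR; lra.
have np : 0 < n%:R - p by lra.
have [C1 C10 hC1] := decay_step a00.
pose A := C1 * M `^ n%:R^-1.
have A0 : 0 < A by rewrite mulr_gt0// powR_gt0.
exists A => // u hu hnz b /andP[a0b b1] hb.
have [m m0 um] := sup_value_exists M0 hu hnz.
have b01 : 0 < b < 1 by rewrite b1 andbT; lra.
have [Cb Cb0 hCb] := subcritical_decay b01 hb.
pose S := [set `|u x| / d x `^ b | x in Omega].
have ubS : ubound S (Cb * m).
  move=> _ [x Ox <-]; rewrite ler_pdivrMr ?powR_gt0 ?(dist_gt0 n0 hO)//.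
  exact: (hCb M u m M0 hu m0 um x Ox).
have [[x0 O0 ux0] _] := um.
have hS : has_sup S by split; [exists (`|u x0| / d x0 `^ b); exists x0|exists (Cb * m)].
pose K := sup S.
have hK x : Omega x -> `|u x| <= K * d x `^ b.
  move=> Ox; rewrite -ler_pdivrMr ?powR_gt0 ?(dist_gt0 n0 hO)//.
  by apply: ub_le_sup; [exists (Cb * m)|exists x].
have K0 : 0 < K.
  apply: (@lt_le_trans _ _ (`|u x0| / d x0 `^ b)).
    by rewrite divr_gt0 ?powR_gt0 ?(dist_gt0 n0 hO)// ux0.
  by apply: ub_le_sup; [exists (Cb * m)|exists x0].
have bI : 0 <= b <= 1 by apply/andP; split; lra.
have aI : a0 <= b < 1 by rewrite a0b.
have cond : n%:R * b - 2 <= p * b - alpha by lra.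
have KT : K <= C1 / (1 - b) * (M * K `^ p) `^ n%:R^-1.
  apply: ge_sup; first by case: hS.
  move=> _ [x Ox <-]; rewrite ler_pdivrMr ?powR_gt0 ?(dist_gt0 n0 hO)//.
  exact: (hC1 M u b b K M0 hu aI bI K0 cond hK x Ox).
have KA : K `^ (1 - p / n%:R) <= A / (1 - b).
  have Kp : 0 < K `^ (p / n%:R) by exact: powR_gt0.
  rewrite -(ler_pM2r Kp) -powRD; last by rewrite (gt_eqF K0) implybT.
  rewrite subrK powRr1 ?(ltW K0)//; apply: le_trans KT _.
  rewrite powRM ?powR_ge0 ?(ltW M0)// -powRrM /A.
  by rewrite le_eqVlt; apply/orP; left; apply/eqP; ring.
have KE : K <= (A / (1 - b)) `^ (n%:R / (n%:R - p)).
  have -> : K = (K `^ (1 - p / n%:R)) `^ (n%:R / (n%:R - p)).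
    rewrite -powRrM (_ : _ * _ = 1) ?powRr1 ?(ltW K0)//.
    by field; rewrite !gt_eqF.
  apply: ge0_ler_powR; rewrite ?nnegrE ?powR_ge0//.
    by rewrite divr_ge0// ltW.
  by rewrite divr_ge0 ?(ltW A0)//; lra.
move=> x Ox; apply: le_trans (hK x Ox) _.
by rewrite ler_wpM2r ?powR_ge0.
Qed.

(** The factor t^(- s) equals exp (- s ln t); this is applied with s of order
    1 / |ln t|. *)
Lemma powR_shift (t b s : R) : 0 < t -> 0 <= s -> s * `|ln t| <= 1 ->
  t `^ (b - s) <= expR 1 * t `^ b.
Proof.
move=> t0 s0 hs; rewrite powRD; last by rewrite (gt_eqF t0) implybT.
rewrite mulrC ler_wpM2r ?powR_ge0// /powR (gt_eqF t0) ler_expR.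
apply: le_trans hs; rewrite mulNr -mulrN ler_wpM2l//.
by rewrite -normrN ler_norm.
Qed.

(** The exponent b of [sharp_power_decay] is taken at distance of order
    1 / (1 + |ln (d x)|) from the critical one. *)
Lemma critical_decay (M : R) : p < n%:R -> 2 - alpha < n%:R - p -> 0 < M ->
  exists2 C : R, 0 < C &
  forall u : 'rV[R]_n -> R,
    convex_solution Omega alpha p M u -> nonzero_on (closure Omega) u ->
    forall x, Omega x -> `|u x| <= C * d x `^ ((2 - alpha) / (n%:R - p)).
Proof.
move=> pn hlt M0; case/andP: halpha => al0' al2.
have np : 0 < n%:R - p by lra.
pose be := (2 - alpha) / (n%:R - p).
have be0 : 0 < be by rewrite divr_gt0//; lra.
have be1 : be < 1 by rewrite ltr_pdivrMr// mul1r.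
have beE : be * (n%:R - p) = 2 - alpha by rewrite divfK// gt_eqF.
have be2 : 0 < be / 2 by rewrite divr_gt0.
have [C C0 hC] := sharp_power_decay pn be2 M0.
have C1 : 0 < C / (1 - be) by rewrite divr_gt0//; lra.
exists ((C / (1 - be)) `^ (n%:R / (n%:R - p)) * expR 1).
  by rewrite mulr_gt0 ?powR_gt0 ?expR_gt0.
move=> u hu hnz x Ox; have dx := dist_gt0 n0 hO Ox.
pose L := `|ln (d x)|; have L0 : 0 <= L by exact: normr_ge0.
have L1 : 0 < 1 + L by lra.
pose s := be / 2 / (1 + L).
have s0 : 0 < s by rewrite divr_gt0.
have sL : s * (1 + L) = be / 2 by rewrite divfK// gt_eqF.
have sb : s <= be / 2 by nra.
have bI : be / 2 <= be - s < 1 by apply/andP; split; lra.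
have cond : n%:R * (be - s) < 2 - alpha + p * (be - s).
  have nps : 0 < (n%:R - p) * s by exact: mulr_gt0.
  by lra.
apply: le_trans (hC u hu hnz (be - s) bI cond x Ox) _.
rewrite -mulrA; apply: ler_pM; rewrite ?powR_ge0//.
  apply: ge0_ler_powR; rewrite ?nnegrE ?(ltW C1)//.
  - by rewrite divr_ge0// ltW.
  - by rewrite divr_ge0 ?(ltW C0)//; lra.
  - by rewrite ler_pM2l// lef_pV2 ?posrE; lra.
apply: powR_shift => //; first exact: ltW.
by rewrite -/L; nra.
Qed.

(** Here the critical exponent is 1, and b = 1 - 1 / (2 + |ln (d x)|) turns the
    blow-up of the constant as b tends to 1 into the logarithmic factor. *)
Lemma log_decay (M : R) : p - alpha = n%:R - 2 -> 0 < M ->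
  exists2 C : R, 0 < C &
  forall u : 'rV[R]_n -> R,
    convex_solution Omega alpha p M u -> nonzero_on (closure Omega) u ->
    forall x, Omega x ->
      `|u x| <= C * d x * (1 + `|ln (d x)| `^ (n%:R / (2 - alpha))).
Proof.
move=> hpa M0; case/andP: halpha => al0' al2.
have pn : p < n%:R by lra.
have npE : n%:R - p = 2 - alpha by lra.
have h2 : 0 < 2^-1 :> R by rewrite invr_gt0.
have [C C0 hC] := sharp_power_decay pn h2 M0.
rewrite npE in hC; set g := n%:R / (2 - alpha) in hC *.
have nn0 : 0 < n%:R :> R by have := nR; lra.
have g0 : 0 < g by rewrite divr_gt0//; lra.
exists ((4 * C) `^ g * expR 1); first by rewrite mulr_gt0 ?powR_gt0 ?expR_gt0 ?mulr_gt0.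
move=> u hu hnz x Ox; have dx := dist_gt0 n0 hO Ox.
pose L := `|ln (d x)|; have L0 : 0 <= L by exact: normr_ge0.
pose s := (2 + L)^-1.
have L2 : 0 < 2 + L by lra.
have s0 : 0 < s by rewrite invr_gt0.
have sE : s * (2 + L) = 1 by rewrite mulVf// gt_eqF.
have s2 : s <= 2^-1 by rewrite lef_pV2 ?posrE; lra.
have bI : 2^-1 <= 1 - s < 1 by apply/andP; split; lra.
have cond : n%:R * (1 - s) < 2 - alpha + p * (1 - s).
  have np : 0 < n%:R - p by lra.
  have nps : 0 < (n%:R - p) * s by exact: mulr_gt0.
  by lra.
apply: le_trans (hC u hu hnz (1 - s) bI cond x Ox) _.
rewrite opprB addrC subrK invrK.
have hd : d x `^ (1 - s) <= expR 1 * d x.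
  rewrite -{2}[d x]powRr1 ?(ltW dx)//; apply: powR_shift => //; first exact: ltW.
  by rewrite -/L; lra.
have hL : (C * (2 + L)) `^ g <= (4 * C) `^ g * (1 + L `^ g).
  have [l1|l1] := leP L 1.
    apply: (@le_trans _ _ ((4 * C) `^ g)).
      apply: ge0_ler_powR; rewrite ?nnegrE ?(ltW g0) ?mulr_ge0 ?(ltW C0) ?(ltW L2)//.
      by rewrite mulrC ler_pM2r//; lra.
    by rewrite ler_peMr ?powR_ge0// lerDl powR_ge0.
  apply: (@le_trans _ _ ((4 * C * L) `^ g)).
    apply: ge0_ler_powR; rewrite ?nnegrE ?(ltW g0) ?mulr_ge0 ?(ltW C0) ?(ltW L2)//.
    by rewrite [4 * C]mulrC -mulrA ler_pM2l//; lra.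
  rewrite powRM ?mulr_ge0 ?(ltW C0)// ler_wpM2l ?powR_ge0//.
  by rewrite lerDr.
apply: (@le_trans _ _ ((4 * C) `^ g * (1 + L `^ g) * (expR 1 * d x))).
  by apply: ler_pM; rewrite ?powR_ge0.
by rewrite le_eqVlt; apply/orP; left; apply/eqP; ring.
Qed.
End decay.

(** * Linear growth, Lipschitz bound and conclusion *)

Section lipschitz.
Variables (R : realType) (n : nat) (Omega : set 'rV[R]_n).
Variables (alpha p : R).
Hypothesis hn : (2 <= n)%N.
Hypothesis hO : bounded_convex_domain Omega.
Hypothesis halpha : 0 <= alpha < 2.
Hypothesis hp : 0 < p.
Implicit Types x y z : 'rV[R]_n.
Local Notation d := (dist_frontier Omega).

Let n0 : (0 < n)%N. Proof. exact: ltnW. Qed.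

(** If u y > u x, follow the ray from x through y to the frontier. On it u is
    convex and nonpositive, so its mean slope from x to y is at most about |u x|
    divided by the length of the ray, which is at least d x. *)
Lemma linear_growth_lipschitz (M K : R) (u : 'rV[R]_n -> R) : 0 < M -> 0 < K ->
  convex_solution Omega alpha p M u ->
  (forall x, Omega x -> `|u x| <= K * d x) ->
  lipschitz_on_set (closure Omega) u.
Proof.
move=> M0 K0 hu hK; exists (2 * K).
have ufr x : frontier Omega x -> u x = 0 by case: hu => _ _ _; apply.
have one x y : Omega x -> Omega y -> u y - u x <= 2 * K * enorm (x - y).
  move=> Ox Oy; have [->|yx] := eqVneq y x.
    by rewrite !subrr enorm0 mulr0.
  have e0 : y - x != 0 by rewrite subr_eq0.
  have [s [s0 fs Os]] := ray_exit hO Ox e0.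
  have s1 : 1 < s.
    rewrite ltNge; apply/negP => s1; apply: (frontier_notin hO fs).
    by apply: (domain_conv hO Ox Oy); rewrite (ltW s0).
  (* r is a parameter beyond y and at least halfway to the exit. *)
  pose r := (1 + s) / 2.
  have rI : 0 <= r < s by rewrite /r; apply/andP; split; lra.
  have r1 : 1 < r by rewrite /r; lra.
  have Oz := Os r rI.
  have t01 : 0 <= r^-1 <= 1 by rewrite invr_ge0 invf_le1; lra.
  have := solution_conv hu Ox Oz t01.
  rewrite [x + _ - x]addrC addKr scalerA mulVf ?scale1r; last by rewrite gt_eqF//; lra.
  rewrite [x + _]addrC subrK.
  have uz := solution_le0 n0 hO hu (subset_closure Oz).
  have ux := hK x Ox; rewrite (normr_solution n0 hO hu Ox) in ux.
  have dx := dist_le x fs.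
  rewrite opprD addrA subrr add0r enormN enormZ gtr0_norm// in dx.
  rewrite [enorm (x - y)]enorm_sub; set e := enorm (y - x) in dx *.
  have e_ge0 : 0 <= e by exact: enorm_ge0.
  have rz : r^-1 * u (x + r *: (y - x)) <= 0.
    by rewrite mulr_ge0_le0// invr_ge0; lra.
  move=> h; have h1 : u y - u x <= r^-1 * (K * (s * e)).
    have : r^-1 * - u x <= r^-1 * (K * (s * e)).
      rewrite ler_wpM2l ?invr_ge0//; first by lra.
      by apply: le_trans ux _; rewrite ler_pM2l.
    by lra.
  apply: le_trans h1 _.
  rewrite ler_pdivrMl; last by lra.
  have -> : r * (2 * K * e) = K * ((2 * r) * e) by ring.
  rewrite ler_pM2l// ler_wpM2r// /r; lra.
have two x y : Omega x -> frontier Omega y -> `|u x - u y| <= 2 * K * enorm (x - y).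
  move=> Ox fy; rewrite (ufr y fy) subr0.
  apply: le_trans (hK x Ox) _; rewrite -mulrA mulrCA ler_pM2l//.
  apply: le_trans (dist_le x fy) _.
  by have := enorm_ge0 (x - y); lra.
move=> x y /closure_domain[Ox|fx] /closure_domain[Oy|fy].
- rewrite ler_norml; apply/andP; split; last by rewrite enorm_sub; exact: one.
  by rewrite lerNl opprB; exact: one.
- exact: two.
- by rewrite distrC enorm_sub; exact: two.
- by rewrite !ufr// subrr normr0 !mulr_ge0 ?enorm_ge0// ltW.
Qed.

(** By continuity |u| stays close to its maximum on a slab ball, which has
    positive measure, so the essential supremum is not smaller. *)
Lemma sup_value_le_Linfty (M m : R) (u : 'rV[R]_n -> R) : 0 < M ->
  convex_solution Omega alpha p M u -> 0 < m -> sup_value Omega u m ->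
  (m%:E <= Linfty_norm Omega u)%E.
Proof.
move=> M0 hu m0 [[x0 O0 um] _].
have [nu enu _] := dist_support n0 hO O0.
have d0 := dist_gt0 n0 hO O0.
rewrite /Linfty_norm unlock/=.
have TT : (0 < @leb R n [set: lebesgue_space R n])%E.
  have := slab_ball_gt0 enu 0 (@ltr01 R) (@ltr01 R).
  by move=> /lt_le_trans; apply; exact: le_lebesgue_outer.
rewrite TT; apply: le_ereal_inf_tmp => y [N [mN N0 hN]].
rewrite leNgt; apply/negP => ym.
have [r r0 rV] : exists2 r : R, 0 < r & forall x, Omega x -> enorm (x - x0) < r ->
    (y < `|u x|%:E)%E.
  case: y ym hN => [y| |]//; last first.
    by move=> _ _; exists 1 => // x _ _; rewrite ltNyr.
  rewrite lte_fin => ym _.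
  have ym0 : 0 < m - y by lra.
  have [r r0 hr] := solution_continuous_enorm hu (subset_closure O0) ym0.
  exists r => // x Ox xr; rewrite lte_fin.
  have := hr x (subset_closure Ox) xr; have := ler_normB (u x) (u x - u x0).
  by rewrite subKr um; lra.
pose t := Num.min r (d x0).
have t0 : 0 < t by rewrite lt_min r0.
pose E := slab_ball nu x0 t t.
have EN : E `<=` N.
  move=> x [/= + _]; rewrite lt_min => /andP[xr xd]; apply: hN => /= h.
  have Ox := dist_ball hO O0 xd.
  by have := rV x Ox xr; rewrite ltNge => /negP; apply; rewrite patchT ?inE in h.
have := slab_ball_gt0 enu x0 t0 t0.
by move=> /lt_le_trans/(_ (le_lebesgue_outer EN)); rewrite [X in (_ < X)%E]N0 ltxx.
Qed.

(** Since 2 - alpha + p > n, an exponent b < 1 can be chosen for which the next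
    improvement step admits some a = 1 + t > 1. *)
Lemma linear_decay : n%:R - 2 < p - alpha -> exists2 C : R, 0 < C &
  forall (M : R) (u : 'rV[R]_n -> R) (m : R), 0 < M ->
    convex_solution Omega alpha p M u -> 0 < m -> sup_value Omega u m ->
    forall x, Omega x -> `|u x| <= C * m * d x.
Proof.
move=> hlt; case/andP: halpha => al0 al2; have p0 := hp.
have nR : 2 <= n%:R :> R by rewrite (ler_nat _ 2).
have nn0 : 0 < n%:R :> R by lra.
pose eta := p - alpha - (n%:R - 2); have eta0 : 0 < eta by rewrite subr_gt0.
pose s : R := Num.min 2^-1 (eta / (2 * p)).
have s0 : 0 < s by rewrite lt_min invr_gt0 ltr0n/= divr_gt0// mulr_gt0.
have s2 : s <= 2^-1 by rewrite ge_min lexx.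
have sp : p * s <= eta / 2.
  have : s <= eta / (2 * p) by rewrite ge_min lexx orbT.
  by rewrite ler_pdivlMr ?mulr_gt0//; lra.
pose b := 1 - s.
have b01 : 0 < b < 1 by rewrite /b; apply/andP; split; lra.
have hb : n%:R * b < 2 - alpha + p * b.
  have ns : 0 < n%:R * s by exact: mulr_gt0.
  by rewrite /b; rewrite /eta in sp eta0; lra.
pose t : R := Num.min 1 (eta / (2 * n%:R)).
have t0 : 0 < t by rewrite lt_min ltr01/= divr_gt0// mulr_gt0.
have t1 : t <= 1 by rewrite ge_min lexx.
have nt : n%:R * t <= eta / 2.
  have : t <= eta / (2 * n%:R) by rewrite ge_min lexx orbT.
  by rewrite ler_pdivlMr ?mulr_gt0//; lra.
have aI : 1 < 1 + t <= 2 by apply/andP; split; lra.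
have [C1 C10 hC1] := subcritical_decay hn hO halpha hp b01 hb.
have [C2 C20 hC2] := mass_bound_root hn hO halpha hp.
have [C3 C30 hC3] := decay_step_linear hn hO halpha hp aI.
have bI : 0 <= b <= 1 by apply/andP; split; lra.
have cond : n%:R * (1 + t) - 2 <= p * b - alpha.
  by rewrite /b; rewrite /eta in sp nt; lra.
exists (C3 * (C2 * C1 `^ p) `^ n%:R^-1).
  by rewrite mulr_gt0 ?powR_gt0 ?mulr_gt0 ?powR_gt0.
move=> M u m M0 hu m0 um x Ox.
have Cm : 0 < C1 * m by rewrite mulr_gt0.
have := hC3 M u b (C1 * m) M0 hu bI Cm cond (hC1 M u m M0 hu m0 um) x Ox.
move/le_trans; apply; rewrite ler_wpM2r ?(ltW (dist_gt0 n0 hO Ox))//.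
rewrite -[leRHS]mulrA ler_pM2l//.
exact: (hC2 M u m C1 M0 hu m0 um C10).
Qed.

End lipschitz.

Theorem theorem1p5 (R : realType) (n : nat) (Omega : set 'rV[R]_n)
    (alpha p : R) (hn : (2 <= n)%N) (hOmega : bounded_convex_domain Omega)
    (halpha : 0 <= alpha < 2) (hp : 0 < p) :
  [/\ (n%:R - 2 < p - alpha ->
        exists2 C : R, 0 < C &
        forall (M : R) (u : 'rV[R]_n -> R), 0 < M ->
          convex_solution Omega alpha p M u -> nonzero_on (closure Omega) u ->
          lipschitz_on_set (closure Omega) u /\
          forall x, Omega x ->
            (`|u x|%:E <=
              (C * dist_frontier Omega x)%:E * Linfty_norm Omega u)%E),
      (p - alpha = n%:R - 2 ->
        forall M : R, 0 < M ->
        exists2 C : R, 0 < C &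
        forall u : 'rV[R]_n -> R,
          convex_solution Omega alpha p M u -> nonzero_on (closure Omega) u ->
          forall x, Omega x ->
            `|u x| <= C * dist_frontier Omega x *
              (1 + `|ln (dist_frontier Omega x)| `^ (n%:R / (2 - alpha)))),
      (p - alpha < n%:R - 2 ->
        forall M : R, 0 < M ->
        forall beta : R, 0 < beta < (2 - alpha) / (n%:R - p) ->
        exists2 C : R, 0 < C &
        forall u : 'rV[R]_n -> R,
          convex_solution Omega alpha p M u -> nonzero_on (closure Omega) u ->
          forall x, Omega x ->
            `|u x| <= C * dist_frontier Omega x `^ beta) &
      (n%:R * (alpha - 1) - 2 < p - alpha < n%:R - 2 ->
        forall M : R, 0 < M ->
        exists2 C : R, 0 < C &
        forall u : 'rV[R]_n -> R,
          convex_solution Omega alpha p M u -> nonzero_on (closure Omega) u ->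
          forall x, Omega x ->
            `|u x| <= C * dist_frontier Omega x `^ ((2 - alpha) / (n%:R - p)))].
Proof.
have n0 : (0 < n)%N by exact: ltnW.
have /andP[al0 al2] := halpha.
split.
- move=> hlt; have [C C0 hC] := linear_decay hn hOmega halpha hp hlt.
  exists C => // M u M0 hu hnz.
  have [m m0 um] := sup_value_exists hn hOmega M0 hu hnz.
  have hK := hC M u m M0 hu m0 um.
  split; first exact: (linear_growth_lipschitz hn hOmega M0 (mulr_gt0 C0 m0) hu hK).
  move=> x Ox; have dx := dist_gt0 n0 hOmega Ox.
  apply: (@le_trans _ _ ((C * dist_frontier Omega x)%:E * m%:E)%E).
    by rewrite -EFinM lee_fin mulrAC; exact: hK.
  rewrite lee_pmul2l//; last by rewrite lte_fin mulr_gt0.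
  exact: (sup_value_le_Linfty hn hOmega M0 hu m0 um).
- by move=> hpa M M0; exact: log_decay.
- move=> hlt M M0 beta /andP[b0 bb].
  have [D D1 hD] := dist_bounded n0 hOmega.
  have pn : p < n%:R by lra.
  have np : 2 - alpha < n%:R - p by lra.
  have [C C0 hC] := critical_decay hn hOmega halpha hp pn np M0.
  pose be := (2 - alpha) / (n%:R - p).
  have D0 : 0 < D by exact: lt_le_trans D1.
  exists (C * D `^ (be - beta)); first by rewrite mulr_gt0// powR_gt0.
  move=> u hu hnz x Ox; apply: le_trans (hC u hu hnz x Ox) _.
  have dx := dist_gt0 n0 hOmega Ox.
  rewrite -mulrA ler_pM2l// -/be -[X in _ `^ X](subrK beta).
  rewrite powRD; last by rewrite (gt_eqF dx) implybT.
  rewrite ler_wpM2r ?powR_ge0//; apply: ge0_ler_powR; rewrite ?nnegrE ?(ltW dx) ?(ltW D0)//.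
    by rewrite subr_ge0 ltW.
  by have [] := hD x Ox.
- move=> /andP[_ hlt] M M0.
  by apply: critical_decay => //; lra.
Qed.
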